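(* Let $w\in S_n$. If $d$ is the complexity of $Y_w$, then the complexities of $Y_w^{\mathrm{low}}$ and of $Y_w^{\mathrm{sym}}$ are both given by $$d-|\mathrm{SW}(w)\cap\Delta^{\mathrm{up}}| .$$
   Context: $w$ is identified with the permutation matrix with $1$s at $(w(j),j)$; $r_M(a,b)$ is the rank of the submatrix of $M$ with rows $a,\dots,n$ and columns $1,\dots,b$. $D^\circ(w)=\{(i,j): w(j)<i,\ w^{-1}(i)>j\}$; $\mathrm{Ess}(w)$ is the set of north-east corners of its connected components; $\mathrm{dom}(w)$ is the connected component of $D^\circ(w)$ containing $(n,1)$ (possibly empty); $\mathrm{SW}(w)$ is the set of cells weakly south-west of an element of $\mathrm{Ess}(w)$; $L(w)=\mathrm{SW}(w)\setminus\mathrm{dom}(w)$, $L'(w)=\mathrm{SW}(w)\setminus D^\circ(w)$. $\Delta^{\mathrm{low}}=\{(i,j)\in[n]^2: i\ge j\}$, $\Delta^{\mathrm{up}}=\{(i,j)\in[n]^2: i<j\}$. The matrix Schubert variety $\overline{X_w}=\overline{BwB}\subseteq\mathbb C^{n\times n}$ is defined by the Fulton conditions $r_M(a,b)\le r_w(a,b)$, $(a,b)\in\mathrm{Ess}(w)$. $\overline{X_w^{\mathrm{sym}}}$ (resp. $\overline{X_w^{\mathrm{low}}}$) is the variety obtained by imposing the Fulton conditions on a generic symmetric (resp. lower triangular) $n\times n$ matrix. $Y_w$ is the projection of $\overline{X_w}$ to the entries in $L(w)$, so $\overline{X_w}=Y_w\times\mathbb C^{n^2-|\mathrm{SW}(w)|}$,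 $\dim Y_w=|L'(w)|$. Similarly $\overline{X_w^{\mathrm{sym}}}=Y_w^{\mathrm{sym}}\times\mathbb C^{d'}$ and $\overline{X_w^{\mathrm{low}}}=Y_w^{\mathrm{low}}\times\mathbb C^{d'}$ with $d'=|\Delta^{\mathrm{low}}\setminus\mathrm{SW}(w)|$, where $Y_w^{\mathrm{sym}}$ is the projection to the entries of $L(w)$ and its reflection in the diagonal, and $Y_w^{\mathrm{low}}$ is the projection to the entries of $L(w)\cap\Delta^{\mathrm{low}}$. With $e_1,\dots,e_n,f_1,\dots,f_n$ the standard basis of $\mathbb Z^n\times\mathbb Z^n$, the weight cones are $\sigma_w=\mathrm{Cone}(e_i-f_j : (i,j)\in L(w))$ and $\sigma_w^{\mathrm{sym}}=\sigma_w^{\mathrm{low}}=\mathrm{Cone}(e_i-f_j : (i,j)\in L(w)\cap\Delta^{\mathrm{low}})$. The complexity of $Y_w$, $Y_w^{\mathrm{sym}}$, $Y_w^{\mathrm{low}}$ is its dimension minus the dimension of the corresponding weight cone. *)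

(* Defs.v *)
From HB Require Import structures.
From mathcomp Require Import all_boot all_order all_algebra fingroup perm.
From mathcomp Require Import classical_sets reals.
From mathcomp Require Import complex mpoly.

Set Implicit Arguments.
Unset Strict Implicit.
Unset Printing Implicit Defensive.

Import Order.TTheory GRing.Theory Num.Theory.
Local Open Scope ring_scope.

(* Rows and columns are numbered from 0, rows from top to bottom: the cell
   (i, j) below is the cell (i+1, j+1) of [n]^2.  "South" means larger row
   index and "west" means smaller column index. *)
Definition cell (n : nat) := ('I_n * 'I_n)%type.

Section Diagrams.
Variables (n : nat) (w : 'S_n).
Implicit Types c : cell n.

Definition diagram : {set cell n} :=
  [set c : cell n | (w c.2 < c.1)%N && (c.2 < (w^-1)%g c.1)%N].

Definition north c c' := (c'.1.+1 == c.1 :> nat) && (c'.2 == c.2).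
Definition east c c' := (c'.1 == c.1) && (c'.2 == c.2.+1 :> nat).

Definition adjacent c c' :=
  [|| north c c', north c' c, east c c' | east c' c].

Definition diagram_edge : rel (cell n) := fun c c' =>
  [&& c \in diagram, c' \in diagram & adjacent c c'].

Definition component c : {set cell n} :=
  [set c' in diagram | connect diagram_edge c c'].

Definition Ess : {set cell n} :=
  [set c in diagram |
    [forall c' in component c, ~~ north c c' && ~~ east c c']].

Definition sw_corner c := (c.1.+1 == n :> nat) && (c.2 == 0 :> nat).

Definition dom : {set cell n} :=
  \bigcup_(c in diagram | sw_corner c) component c.

Definition SW : {set cell n} :=
  [set c : cell n | [exists e in Ess, (e.1 <= c.1)%N && (c.2 <= e.2)%N]].

Definition Lset : {set cell n} := SW :\: dom.

End Diagrams.

Definition Dlow (n : nat) : {set cell n} := [set c : cell n | (c.2 <= c.1)%N].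
Definition Dup (n : nat) : {set cell n} := [set c : cell n | (c.1 < c.2)%N].

Definition reflect_cells (n : nat) (A : {set cell n}) : {set cell n} :=
  [set (c.2, c.1) | c in A].

(* Affine space K^I for a finite index type I; polynomial functions on it are
   polynomials in #|I| variables, matched to I by the enumeration of I. *)
Section AffineSpace.
Variables (K : fieldType) (I : finType).
Implicit Types X : set (I -> K).

Definition peval (p : {mpoly K[#|I|]}) (x : I -> K) : K :=
  p.@[fun k => x (enum_val k)].

Definition zariski_closure X : set (I -> K) := [set x |
  forall p, (forall y, X y -> peval p y = 0) -> peval p x = 0]%classic.

(* Algebraic independence of the classes of f_0, ..., f_(d-1) in the
   coordinate ring of X (polynomials modulo those vanishing on X). *)
Definition alg_independent_on X (d : nat) (f : 'I_d -> {mpoly K[#|I|]}) :=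
  forall P : {mpoly K[d]},
    (forall x, X x -> P.@[fun k => peval (f k) x] = 0) -> P = 0.

(* The dimension of a nonempty affine variety, irreducible or not, as the
   transcendence degree of its coordinate ring. *)
Definition variety_dim X (d : nat) : Prop :=
  (exists f : 'I_d -> {mpoly K[#|I|]}, alg_independent_on X f) /\
  (forall (e : nat) (f : 'I_e -> {mpoly K[#|I|]}),
     alg_independent_on X f -> (e <= d)%N).

End AffineSpace.

Section Varieties.
Variables (K : fieldType) (n : nat) (w : 'S_n).

Definition permutation_matrix : 'M[K]_n := \matrix_(i, j) (i == w j)%:R.

Definition sw_rank (M : 'M[K]_n) (c : cell n) : nat :=
  \rank (mxsub (@enum_val _ [pred i : 'I_n | (c.1 <= i)%N])
               (@enum_val _ [pred j : 'I_n | (j <= c.2)%N]) M).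

(* is_trig_mx means lower triangular, so B consists of the invertible upper
   triangular matrices; these preserve sw_rank on either side. *)
Definition borel : set 'M[K]_n :=
  [set b | (b \in unitmx) && is_trig_mx b^T]%classic.

Definition BwB : set 'M[K]_n := [set M | exists b b',
  [/\ borel b, borel b' & M = b *m permutation_matrix *m b']]%classic.

Definition entries (M : 'M[K]_n) : cell n -> K := fun c => M c.1 c.2.

Definition matrix_schubert : set 'M[K]_n :=
  [set M | zariski_closure (entries @` BwB) (entries M)]%classic.

Definition fulton (M : 'M[K]_n) : Prop := forall c, c \in Ess w ->
  (sw_rank M c <= sw_rank permutation_matrix c)%N.

Definition matrix_schubert_sym : set 'M[K]_n :=
  [set M | M^T = M /\ fulton M]%classic.

Definition matrix_schubert_low : set 'M[K]_n :=
  [set M | is_trig_mx M /\ fulton M]%classic.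

Definition project (S : {set cell n}) (X : set 'M[K]_n) :
    set ({c : cell n | c \in S} -> K) :=
  [set (fun c => entries M (val c)) | M in X]%classic.

Definition Y := @project (Lset w) matrix_schubert.

Definition Ysym :=
  @project (Lset w :|: reflect_cells (Lset w)) matrix_schubert_sym.

Definition Ylow := @project (Lset w :&: Dlow n) matrix_schubert_low.

End Varieties.

Arguments Y K {n} w.
Arguments Ysym K {n} w.
Arguments Ylow K {n} w.

Section Cones.
Variables (R : realFieldType) (n : nat).

Definition ray (c : cell n) : 'rV[R]_n * 'rV[R]_n :=
  (delta_mx 0 c.1, - delta_mx 0 c.2).

Definition weight_cone (A : {set cell n}) : set ('rV[R]_n * 'rV[R]_n) :=
  [set \sum_(c in A) a c *: ray c |
     a in [set a : cell n -> R | forall c, 0 <= a c]]%classic.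

Definition sigma (w : 'S_n) := weight_cone (Lset w).
Definition sigma_low (w : 'S_n) := weight_cone (Lset w :&: Dlow n).
Definition sigma_sym (w : 'S_n) := weight_cone (Lset w :&: Dlow n).

End Cones.

Arguments sigma R {n} w.
Arguments sigma_low R {n} w.
Arguments sigma_sym R {n} w.

(* The dimension of a cone is that of its linear span, i.e. of the smallest
   subspace containing it. *)
Definition cone_dim (R : fieldType) (V : vectType R) (C : set V) (d : nat) :=
  exists U : {vspace V},
    [/\ forall v, C v -> v \in U,
        forall W : {vspace V}, (forall v, C v -> v \in W) -> (U <= W)%VS
      & \dim U = d].

Definition complexity (K : fieldType) (I : finType) (X : set (I -> K))
    (R : fieldType) (V : vectType R) (C : set V) (d : int) : Prop :=
  exists a b : nat, [/\ variety_dim X a, cone_dim C b & d = a%:Z - b%:Z].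

(* Main.v *)
Require Import Defs.
From mathcomp Require Import all_boot all_order all_algebra fingroup perm.
From mathcomp Require Import classical_sets reals.
From mathcomp Require Import complex mpoly.
From mathcomp Require Import boolp zify.

(* The three dimensions are |SW(w)| - |D(w)| for Y_w and |SW(w) n Dlow| - |D(w)| for both Y_w^low
   and Y_w^sym, while the two weight cones have the same span.

   Upper bounds: the diagonal term of every minor of size r_w(a,b) + 1 is its leading term, for a
   weight invariant under transposition. Standard monomials are therefore supported on sets of
   cells without chains of that length, and the growth of the coordinate ring bounds the dimension
   by the size of such a set. Cells above the diagonal lie on no such chain, because
   r_w(a,b) > b - a, so all three bounds reduce to the fact that the complement of a set without
   such chains has at least |D(w)| cells, which is proved by following pipes through the grid.

   Lower bounds: the cells outside D(w) are free coordinates on BwB. A generic element M of BwB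
   has nonzero leading minors, so M = L V with V upper unitriangular and L lower triangular, and
   M = S V' with S = L diag(L)^-1 L^T symmetric. Right multiplication by upper triangular matrices
   preserves the Fulton conditions, so L and S satisfy them, and passing from M to L or S loses
   at most the |Dup| parameters of V. *)

(** Read the cells of a set without long chains as elbows and all other cells as crossings. Deleting
    a crossing removes at most one cell of the Rothe diagram, deleting an elbow none, and the empty
    grid leaves an empty diagram; so at least |D(w)| crossings are present. The growth bound
    compares, for e functions, the number of their products with exponents at most M, of order M^e,
    with the number of standard monomials of comparable degree, of order M^s: for s < e a linear
    relation between the products appears, and it is an algebraic relation between the functions.
    The obstacle in the lower bounds is that the free coordinates on BwB may lie outside L(w), where
    the projection forgets them. They are exchanged for coordinates in L(w) by the same growth
    bound, applied to the leading monomials of hypothetical relations. *)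

Set Implicit Arguments.
Unset Strict Implicit.
Unset Printing Implicit Defensive.

(** * Sets of cells without long chains *)

Section PipeDream.
Variables (n N : nat) (S : nat -> nat -> bool).

(* Rows are numbered from the bottom up here, so that chains still run south-east. *)
Definition climbs (x y : nat * nat) := (y.1 < x.1) && (x.2 < y.2).

Definition rises (u : nat -> nat) (a b : nat) := count (fun j => u j < a) (iota 0 b).

(** Pipes travel only south and east, so those leaving through the [minn g b] columns west of the
    point (r, g) entered before it; each cell of a chain of elbows east of it accounts for one
    more. *)
Definition chain_bound (u : nat -> nat) (r g : nat) := forall b s, b <= n ->
  sorted climbs s ->
  all (fun x => [&& S x.1 x.2, x.1 < r, g <= x.2 & x.2 < b]) s ->
  minn g b + size s <= rises u (r + g) b.

(* The points (r, g) run through the lattice path bounding the region made of the rows below p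
   and of the cells (p, j) with k <= j. Pipes enter through the edges of this path, labelled in
   order from the south-west corner, and u j is the label of the pipe leaving through the bottom
   of column j; r + g edges precede (r, g). *)
Definition pipe_state (p k : nat) (u : nat -> nat) := forall r g,
  [|| (g == 0) && (r <= p), (r == p) && (g <= k) | [&& r == p.+1, k <= g & g <= n]] ->
  chain_bound u r g.

Definition crosses (p k : nat) :=
  \sum_(i < p) \sum_(j < n) ~~ S i j + \sum_(j < n | k <= j) ~~ S p j.

(** Rows stand for values of u. Since u need not hit all N values, the condition on the inverse is
    stated as absence of the value from the columns up to [x.2]. *)
Definition rothe (u : nat -> nat) : {set 'I_N * 'I_n} :=
  [set x : 'I_N * 'I_n |
    (x.1 < u x.2) && [forall j : 'I_n, (j <= x.2) ==> (u j != x.1)]].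

Definition admissible (u : nat -> nat) :=
  {in gtn n &, injective u} /\ (forall j, j < n -> u j < N).

Definition swapv (i m : nat) := if m == i then i.+1 else if m == i.+1 then i else m.

Lemma swapvK i : involutive (swapv i).
Proof.
move=> m; rewrite /swapv.
by case: (eqVneq m i) => ?; [|case: (eqVneq m i.+1) => ?]; repeat case: ifP => ?; lia.
Qed.

Lemma swapv_inj i : injective (swapv i).
Proof. exact: inv_inj (swapvK i). Qed.

Lemma swapv_ltN i m : i.+1 < N -> m < N -> swapv i m < N.
Proof. by rewrite /swapv; repeat case: ifP => ?; lia. Qed.

Lemma swapv_lt i m m' : ~~ ((m == i) && (m' == i.+1)) -> m < m' ->
  swapv i m < swapv i m'.
Proof. by rewrite /swapv; repeat case: ifP => ?; lia. Qed.

Lemma rises_sum u a b : rises u a b = \sum_(0 <= j < b) (u j < a).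
Proof. by rewrite /rises -sumn_count sumnE big_map /index_iota subn0. Qed.

Lemma rises_swap i u a b : a != i.+1 -> rises (swapv i \o u) a b = rises u a b.
Proof.
move=> ai; apply: eq_count => j /=; rewrite /swapv.
by repeat case: ifP => ?; lia.
Qed.

Lemma rises_succ u a b : {in gtn n &, injective u} -> b <= n ->
  rises u a.+1 b = rises u a b + has (fun j => u j == a) (iota 0 b).
Proof.
move=> uI bn; rewrite /rises.
have -> : count (fun j => u j < a.+1) (iota 0 b)
  = count (predU (fun j => u j < a) (fun j => u j == a)) (iota 0 b).
  by apply: eq_count => j /=; rewrite ltnS leq_eqVlt orbC.
have := count_predUI (fun j => u j < a) (fun j => u j == a) (iota 0 b).
rewrite [count (predI _ _) _](_ : _ = count pred0 (iota 0 b)); last first.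
  by apply: eq_count => j /=; case: eqP => [->|_]; rewrite ?ltnn ?andbF.
rewrite count_pred0 addn0 => ->; congr (_ + _).
elim: b bn => [//|b IH] bn.
rewrite -[in LHS]addn1 -[in RHS]addn1 iotaD add0n count_cat has_cat IH 1?ltnW //= orbF addn0.
case: eqP => [ub|]; last by rewrite orbF addn0.
rewrite orbT; case: hasP => // -[j]; rewrite mem_iota add0n => /andP[_ jb] /eqP uj.
suff: j = b by lia.
by apply: uI; rewrite ?inE; lia.
Qed.

(** Exchanging the rows i and i.+1 carries the diagram into the new one, except for a possible cell
    in row i whose column has the value i.+1. *)
Lemma card_rothe_swap u i : i.+1 < N -> {in gtn n &, injective u} ->
  #|rothe u| <= #|rothe (swapv i \o u)| + 1.
Proof.
move=> iN uI.
pose E := [set x : 'I_N * 'I_n | (x.1 == i :> nat) && (u x.2 == i.+1)].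
rewrite -(cardsID E) addnC; apply: leq_add; last first.
  apply/card_le1_eqP => -[a b] [c d]; rewrite !inE /=.
  move=> /andP[_ /andP[/eqP x1 /eqP x2]] /andP[_ /andP[/eqP y1 /eqP y2]].
  have -> : a = c by apply: val_inj; rewrite /= x1 y1.
  suff -> : b = d by [].
  by apply: val_inj; apply: uI; rewrite ?inE ?x2 ?y2 ?ltn_ord.
pose f (x : 'I_N * 'I_n) : 'I_N * 'I_n := (Ordinal (swapv_ltN iN (ltn_ord x.1)), x.2).
have fI : injective f.
  by move=> [a b] [c d] [/swapv_inj/val_inj -> ->].
rewrite -(card_imset _ fI); apply: subset_leq_card; apply/fintype.subsetP => _ /imsetP[x xP ->].
move: xP; rewrite !inE /= => /andP[xE /andP[xu /forallP xn]].
rewrite swapv_lt //=; apply/forallP => j; apply/implyP => jx.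
by rewrite (inj_eq (@swapv_inj i)); move: (xn j); rewrite jx.
Qed.

Lemma admissible_swap u i : i.+1 < N -> admissible u -> admissible (swapv i \o u).
Proof.
move=> iN [uI uN]; split=> [j k jn kn /= /swapv_inj|j jn /=]; first exact: uI.
by apply: swapv_ltN => //; apply: uN.
Qed.

(** In the empty region the empty chain at the points (0, j.+1) forces u j <= j, so the injective u
    is the identity on the columns. *)
Lemma pipe_base u : admissible u -> pipe_state 0 n u -> #|rothe u| = 0.
Proof.
move=> [uI uN] st.
have ule j : j < n -> u j <= j.
  move=> jn; have c : chain_bound u 0 j.+1 by apply: st; lia.
  have := c j.+1 [::] jn isT isT; rewrite minnn addn0 add0n /rises => H.
  have : all (fun k => u k < j.+1) (iota 0 j.+1).
    by rewrite all_count eqn_leq count_size size_iota.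
  by move/allP/(_ j); rewrite mem_iota /= add0n ltnS leqnn => /(_ isT).
have ueq j : j < n -> u j = j.
  elim/ltn_ind: j => j IH jn; apply/eqP; rewrite eqn_leq ule //= leqNgt; apply/negP => ujj.
  have := IH _ ujj (ltn_trans ujj jn) => /uI; rewrite !inE => /(_ (ltn_trans ujj jn) jn).
  by move=> e; move: ujj; rewrite e ltnn.
apply: eq_card0 => -[a b]; rewrite !inE /= ueq //; apply/negP => /andP[ab /forallP].
have an : a < n by apply: ltn_trans ab _.
by move/(_ (Ordinal an)); rewrite /= (ltnW ab) ueq // eqxx.
Qed.

Definition pipe_bound p k := forall u, admissible u -> pipe_state p k u ->
  #|rothe u| <= crosses p k.

(** Both pairs describe the region formed by the rows below p.+1. *)
Lemma pipe_bound_row p : pipe_bound p 0 -> pipe_bound p.+1 n.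
Proof.
move=> H u ua st; apply: leq_trans (H u ua _) _.
  by move=> r g rg; apply: st; move: rg; lia.
rewrite /crosses big_ord_recr /= -addnA leq_add2l.
by rewrite [in leqLHS](eq_bigl xpredT) ?leq_addr.
Qed.

(** The points (p.+1, k) and (p, k.+1) are preceded by equally many edges; if k < b, a chain for the
    second extends by the elbow (p, k) to a chain for the first. *)
Lemma chain_bound_elbow u p k : k < n -> S p k ->
  chain_bound u p.+1 k -> chain_bound u p k.+1.
Proof.
move=> kn Spk st b s bn ss sA; rewrite addnS -addSn.
have [bk|kb] := leqP b k.
  have /minn_idPr := bk; have /minn_idPr := leqW bk => -> e.
  have := st b s bn ss; rewrite e; apply; apply: sub_all sA => x; lia.
have := st b ((p, k) :: s) bn; rewrite /= Spk !leqnn kb /=.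
rewrite path_min_sorted.
  move=> /(_ ss) H; have /H : all (fun x => [&& S x.1 x.2, x.1 < p.+1, k <= x.2 & x.2 < b]) s.
    by apply: sub_all sA => x; lia.
  by rewrite /minn; do 2?case: ltnP => ?; lia.
by apply: sub_all sA => x; rewrite /climbs /=; lia.
Qed.

(* Removing the cell (p, k) exchanges the labels p + k and p + k + 1 if the cell is a crossing
   and the exchange shrinks the Rothe diagram; otherwise the labels stay. *)
Lemma pipe_bound_cell p k : k < n -> pipe_bound p k.+1 -> pipe_bound p k.
Proof.
move=> kn H u ua st.
have crE : crosses p k = (crosses p k.+1 + ~~ S p k).
  rewrite /crosses -addnA; congr (_ + _).
  rewrite (bigD1 (Ordinal kn)) //= addnC; congr (_ + _).
  by apply: eq_bigl => j; rewrite -val_eqE /=; lia.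
rewrite crE; have [Spk|_] := boolP (S p k).
  rewrite addn0; apply: H => // r g.
  have [/andP[/eqP -> /eqP ->] _|rg rg'] := boolP ((r == p) && (g == k.+1)).
    by apply: chain_bound_elbow => //; apply: st; lia.
  by apply: st; lia.
have [uI uN] := ua.
(* The new corner (p, k.+1) sits between the path points (p, k) and (p.+1, k.+1), which are preceded
   by one edge less and one edge more. *)
have H1 b s : b <= n -> sorted climbs s ->
    all (fun x => [&& S x.1 x.2, x.1 < p, k.+1 <= x.2 & x.2 < b]) s ->
    minn k b + size s <= rises u (p + k) b.
  move=> bn ss sA; apply: st => //; first lia.
  by apply: sub_all sA => x; lia.
have H2 b s : b <= n -> sorted climbs s ->
    all (fun x => [&& S x.1 x.2, x.1 < p, k.+1 <= x.2 & x.2 < b]) s ->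
    minn k.+1 b + size s <= rises u (p + k).+2 b.
  move=> bn ss sA; rewrite -addSn -addnS; apply: st => //; first lia.
  by apply: sub_all sA => x; lia.
have [/existsP[x /andP[/eqP ux /hasPn ui]]|/existsPn nd] := boolP [exists x : 'I_n,
    (u x == (p + k).+1) && ~~ has (fun j => u j == p + k) (iota 0 x)].
  have iN : (p + k).+1 < N by rewrite -ux; apply: uN.
  apply: leq_trans (card_rothe_swap iN uI) _; rewrite leq_add2r.
  apply: H; first exact: admissible_swap.
  move=> r g rg b s bn ss sA.
  have [/andP[/eqP rp /eqP gk]|rg'] := boolP ((r == p) && (g == k.+1)); last first.
    by rewrite rises_swap; [apply: st => //; lia|lia].
  subst r g; rewrite addnS rises_succ //; last exact: (admissible_swap iN ua).1.
  rewrite rises_swap ?ltn_eqF //.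
  have := H1 b s bn ss sA; have := H2 b s bn ss sA.
  rewrite !rises_succ //.
  (* Up to column x neither label occurs, so the bound with two more labels suffices; beyond x the
     exchanged label p + k is counted, and the bound at (p, k) suffices. *)
  have [bx|xb] := leqP b x.
    have -> : has (fun j => u j == p + k) (iota 0 b) = false.
      apply/hasP => -[j]; rewrite mem_iota add0n => /andP[_ jb].
      by apply/negP/ui; rewrite mem_iota add0n; lia.
    have -> : has (fun j => u j == (p + k).+1) (iota 0 b) = false.
      apply/hasP => -[j]; rewrite mem_iota add0n => /andP[_ jb] /eqP uj.
      have : j = x by apply: uI; rewrite ?inE ?ux //; lia.
      lia.
    lia.
  have -> : has (fun j => (swapv (p + k) \o u) j == p + k) (iota 0 b).
    apply/hasP; exists (val x); first by rewrite mem_iota.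
    rewrite /= ux /swapv eqxx (_ : (p + k).+1 == p + k = false) ?eqxx //; lia.
  by rewrite /minn; do 2?case: ltnP => ?; lia.
apply: leq_trans (leq_addr _ _); apply: H => // r g rg b s bn ss sA.
have [/andP[/eqP rp /eqP gk]|rg'] := boolP ((r == p) && (g == k.+1)); last first.
  by apply: st => //; lia.
subst r g; rewrite addnS.
have := H1 b s bn ss sA; have := H2 b s bn ss sA; rewrite !rises_succ //.
(* In this branch the label p + k + 1 never occurs before column b unless p + k does. *)
case: (boolP (has (fun j => u j == p + k) (iota 0 b))) => [_|ni].
  by rewrite /minn; do 2?case: ltnP => ?; lia.
have -> : has (fun j => u j == (p + k).+1) (iota 0 b) = false; last by rewrite !addn0.
apply/hasP => -[j]; rewrite mem_iota add0n => /andP[_ jb] uj.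
have jn : j < n by lia.
have := nd (Ordinal jn); rewrite /= uj /= negbK => /hasP[l].
rewrite mem_iota add0n => /andP[_ lj] ul.
by move/hasPn: ni => /(_ l); rewrite mem_iota add0n (ltn_trans lj jb) ul => /(_ isT).
Qed.

Theorem card_rothe_le u : admissible u -> (forall j, j < n -> u j < n) ->
  (forall r, r <= n -> chain_bound u r 0) ->
  #|rothe u| <= \sum_(i < n) \sum_(j < n) ~~ S i j.
Proof.
move=> ua un st.
have B p : pipe_bound p n.
  have row q : pipe_bound q n -> pipe_bound q 0.
    move=> Hq; suff: forall m, m <= n -> pipe_bound q (n - m).
      by move/(_ n (leqnn _)); rewrite subnn.
    elim=> [|m IH] mn; first by rewrite subn0.
    apply: pipe_bound_cell; first lia.
    by rewrite subnSK //; apply: IH; lia.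
  elim: p => [|p IH]; first by move=> u' ua' /(pipe_base ua') ->.
  exact: pipe_bound_row (row _ IH).
have := B n u ua; rewrite /crosses [X in _ + X]big1 ?addn0; last first.
  by move=> j; rewrite leqNgt ltn_ord.
apply=> r g.
have [/andP[/eqP -> rn] _|ng] := boolP ((g == 0) && (r <= n)); first exact: st.
move=> rg b s bn ss sA.
(* At the remaining points r + g is at least n, so every pipe is counted and it is enough to bound
   the chain by its number of columns. *)
have full a : n <= a -> rises u a b = b.
  move=> na; rewrite /rises -[RHS](size_iota 0) ; apply/eqP.
  rewrite -all_count; apply/allP => j; rewrite mem_iota => jb.
  by apply: leq_trans (un _ _) na; lia.
rewrite full; last by move: rg ng; lia.
suff : size s <= b - g by rewrite /minn; case: ltnP; lia.
have : sorted ltn (map snd s).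
  by rewrite sorted_map; apply: sub_sorted ss => x y /andP[].
rewrite ltn_sorted_uniq_leq => /andP[us _].
rewrite -(size_map snd) -(size_iota g (b - g)).
apply: uniq_leq_size us _ => _ /mapP[x /(allP sA) + ->]; rewrite mem_iota; lia.
Qed.
End PipeDream.

(** * Chains bounded by the rank function of w *)

Section Chains.
Variables (n : nat) (w : 'S_n).
Implicit Types (S : {set cell n}) (s : seq (cell n)) (c : cell n).

Definition descends (x y : cell n) := (x.1 < y.1) && (x.2 < y.2).

Lemma descends_trans : transitive descends.
Proof. by move=> y x z; rewrite /descends => /andP[? ?] /andP[? ?]; lia. Qed.

(** The rank r_w as a count of dots. The bound b is exclusive, so the rank at a cell c is
    [dots c.1 c.2.+1]. *)
Definition dots (a b : nat) := \sum_(j < n | j < b) (a <= w j).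

Lemma dots_col a (j : 'I_n) : dots a j.+1 = dots a j + (a <= w j).
Proof.
rewrite /dots (bigD1 j) //= addnC; congr (_ + _).
by apply: eq_bigl => k; rewrite -val_eqE /=; lia.
Qed.

Lemma dots_row (i : 'I_n) b : dots i b = dots i.+1 b + ((w^-1)%g i < b).
Proof.
rewrite /dots (eq_bigr (fun j : 'I_n => (i < w j) + (j == (w^-1)%g i))); last first.
  move=> j _; have -> : (j == (w^-1)%g i) = (w j == i).
    by apply/eqP/eqP => [->|<-]; rewrite ?permKV ?permK.
  by rewrite -val_eqE /=; lia.
rewrite big_split /=; congr (_ + _).
rewrite big_mkcond (bigD1 ((w^-1)%g i)) //= eqxx big1 ?addn0 => [|j /negbTE ->].
  by case: ifP.
by case: ifP.
Qed.

Definition chain_le S a b := forall s, sorted descends s ->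
  all (fun x => [&& x \in S, a <= x.1 & x.2 < b]) s -> size s <= dots a b.

(** The row or column gained by the step has its dot outside the southwest region of c', so the rank
    is constant on components. *)
Lemma dots_step c c' : c \in diagram w -> c' \in diagram w ->
  north c c' || east c c' -> dots c'.1 c'.2.+1 = dots c.1 c.2.+1.
Proof.
rewrite !inE /north /east; case: c c' => [a b] [a' b'] /=.
move=> /andP[_ _] /andP[H1 H2] /orP[/andP[/eqP aa /eqP bb]|/andP[/eqP aa /eqP bb]].
  by rewrite -bb (dots_row a') ltnS [_ <= b']leqNgt H2 addn0 aa.
by rewrite aa in H1 *; rewrite (dots_col a b') [a <= _]leqNgt H1 addn0 bb.
Qed.

Lemma diagram_Ess c : c \in diagram w -> exists2 e, e \in Ess w &
  [/\ e.1 <= c.1, c.2 <= e.2 & dots e.1 e.2.+1 = dots c.1 c.2.+1].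
Proof.
have [m] := ubnP (c.1 + (n - c.2)).
elim: m c => // m IH c cm cD.
have [/exists_inP[d dC dne]|nb] := boolP [exists d in component w c, north c d || east c d].
  move: dC; rewrite inE => /andP[dD _].
  have [||e eE [ed1 ed2 edots]] := IH d; last exists e => //.
    by move: dne cm; rewrite /north /east -!val_eqE /=; have := ltn_ord c.2; have := ltn_ord d.2;
      lia.
    done.
  rewrite edots (dots_step cD dD dne); split=> //.
    by move: dne ed1; rewrite /north /east -!val_eqE /=; lia.
  by move: dne ed2; rewrite /north /east -!val_eqE /=; lia.
exists c => //; rewrite inE cD; apply/forall_inP => d dC.
by move/existsPn: nb => /(_ d); rewrite dC /= negb_or.
Qed.

Lemma diagram_sub_SW : diagram w \subset SW w.
Proof.
apply/fintype.subsetP => c /diagram_Ess[e eE [e1 e2 _]].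
by rewrite inE; apply/exists_inP; exists e; rewrite ?e1.
Qed.

Lemma dom_sub_diagram : dom w \subset diagram w.
Proof.
by apply/fintype.subsetP => c /bigcupP[d /andP[_ _]]; rewrite inE => /andP[].
Qed.

Lemma dots_dom c : c \in dom w -> dots c.1 c.2.+1 = 0.
Proof.
move=> /bigcupP[d /andP[dD dc]]; rewrite inE => /andP[_ /connectP[p pe ->]].
have d0 : dots d.1 d.2.+1 = 0.
  move: dc dD; rewrite inE => /andP[/eqP d1 /eqP d2] /andP[H _].
  rewrite dots_col leqNgt H addn0 /dots big1 // => j; rewrite d2 //.
elim: p d dD d0 {dc} pe => //= x p IH d dD d0 /andP[/and3P[_ xD dx] pe].
apply: IH => //; move: dx; rewrite /adjacent -d0 => /or4P[] H.
- by apply: dots_step => //; rewrite H.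
- by apply/esym/dots_step => //; rewrite H.
- by apply: dots_step => //; rewrite H orbT.
- by apply/esym/dots_step => //; rewrite H orbT.
Qed.

Lemma sum_ltn_le m a : \sum_(i < m) (i < a) <= a.
Proof.
suff -> : \sum_(i < m) (i < a) = minn m a by apply: geq_minr.
by elim: m => [|m IH]; [rewrite big_ord0 min0n|rewrite big_ord_recr /= IH; lia].
Qed.

(** Of the b dots in the first b columns at most a lie in the first a rows. *)
Lemma dots_lower a b : b <= n -> b <= a + dots a b.
Proof.
move=> bn; have lea : \sum_(j < n | j < b) (w j < a) <= a.
  apply: leq_trans (sum_ltn_le n a).
  rewrite [leqRHS](reindex_inj (@perm_inj _ w)) /= big_mkcond leq_sum // => j _.
  by case: ifP.
suff e : \sum_(j < n | j < b) (w j < a) + dots a b = b by rewrite -[leqLHS]e leq_add2r.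
rewrite /dots -big_split /= (eq_bigr (fun=> 1)) => [|j _]; last lia.
by rewrite -(big_ord_widen n (fun=> 1)) // sum1_card card_ord.
Qed.

(** Otherwise w permutes the first k.+1 indices, and the dot in row [e.1] lies west of the diagram
    cell e. *)
Lemma dots_staircase e k : e \in diagram w -> e.1 <= k -> k < e.2 -> 0 < dots k.+1 k.+1.
Proof.
rewrite inE => /andP[_ e2] e1k ke; have := ltn_ord e.2 => en.
rewrite lt0n; apply/negP => /eqP d0.
pose A := [set j : 'I_n | j <= k].
have wA : w @: A = A.
  apply/eqP; rewrite eqEcard card_imset ?leqnn ?andbT; last exact: perm_inj.
  apply/fintype.subsetP => _ /imsetP[j jA ->]; move: jA; rewrite !inE => jk.
  move/eqP: d0; rewrite /dots sum_nat_eq0 => /forall_inP/(_ j).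
  by rewrite ltnS => /(_ jk); lia.
have : e.1 \in A by rewrite inE.
rewrite -{}wA => /imsetP[j]; rewrite inE => jk ej.
by move: e2; rewrite ej permK ltnNge (leq_trans jk (ltnW ke)).
Qed.

Lemma chain_le_diagram S : (forall c, c \in Ess w -> chain_le S c.1 c.2.+1) ->
  forall c, c \in diagram w -> chain_le S c.1 c.2.+1.
Proof.
move=> ess c /diagram_Ess[e /ess eS [e1 e2 e3]] s ss sA; rewrite -e3; apply: eS => //.
by apply: sub_all sA => x /and3P[-> xa xb]; rewrite (leq_trans e1 xa) (leq_trans xb) ?ltnS.
Qed.

(** A corner cell outside the diagram has a dot weakly south of it in its column or weakly west of
    it in its row. Dropping that column or row loses one dot and at most one cell of the chain. *)
Lemma chain_le_all S : (forall c, c \in Ess w -> chain_le S c.1 c.2.+1) ->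
  forall a b, a <= n -> b <= n -> chain_le S a b.
Proof.
move=> ess a b; have [m] := ubnP ((n - a) + b).
elim: m a b => // m IH a b abm an bn s ss sA.
case: b => [|b] in abm bn sA *.
  by case: s ss sA => //= x s _ /andP[/and3P[]].
have [aE|aN] := eqVneq a n.
  case: s ss sA => //= x s _ /andP[/and3P[_ +]].
  by rewrite aE leqNgt ltn_ord.
have an' : a < n by rewrite ltn_neqAle aN.
pose c : cell n := (Ordinal an', Ordinal bn).
have [cD|] := boolP (c \in diagram w).
  exact: (chain_le_diagram ess cD).
rewrite inE negb_and -!leqNgt => /orP[wb|wa].
  have -> : dots a b.+1 = (dots a b).+1 by rewrite (dots_col a (Ordinal bn)) wb addn1.
  case/lastP: s => [//|s x] in ss sA *; rewrite size_rcons ltnS.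
  move: ss sA; rewrite sorted_pairwise ?pairwise_rcons; last exact: descends_trans.
  rewrite all_rcons => /andP[sx ss] /andP[/and3P[_ _ xb] sA].
  apply: IH; rewrite ?(ltnW bn) //; first lia.
    by rewrite sorted_pairwise //; exact: descends_trans.
  apply/allP => y ys; move/allP: sA => /(_ y ys) /and3P[-> -> _] /=.
  by move/allP: sx => /(_ y ys) /andP[_ yx]; apply: leq_trans yx _.
have -> : dots a b.+1 = (dots a.+1 b.+1).+1.
  by rewrite (dots_row (Ordinal an')) ltnS wa addn1.
case: s => [//|x s] in ss sA *; rewrite /= ltnS.
move: ss sA => /=; rewrite path_sortedE; last exact: descends_trans.
move=> /andP[sx ss] /andP[/and3P[_ xa _] sA].
apply: IH => //; first lia.
apply/allP => y ys; move/allP: sA => /(_ y ys) /and3P[-> _ ->].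
by move/allP: sx => /(_ y ys) /andP[xy _]; rewrite andbT /=; apply: leq_ltn_trans xy.
Qed.

End Chains.

Lemma card_chain_le n (w : 'S_n) (S : {set cell n}) :
  (forall c, c \in Ess w -> chain_le w S c.1 c.2.+1) ->
  #|S| + #|diagram w| <= n * n.
Proof.
move=> /chain_le_all; case: n w S => [|m] w S cS.
  by rewrite !(eq_card0 (A := _)) // => -[[]].
(* Reversing the rows turns the dots in the last r rows, counted by [dots], into the values of u
   below r, counted by [rises]. *)
pose row i : 'I_m.+1 := rev_ord (inord i).
pose u j := val (row (w (inord j))).
pose Sn i j := (row i, inord j) \in S.
have inordE (i : 'I_m.+1) : inord i = i by apply: val_inj; rewrite /= inordK.
have un j : j < m.+1 -> u j < m.+1 by move=> _; apply: ltn_ord.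
have ua : admissible m.+1 m.+1 u.
  split=> // i j im jm /val_inj/rev_ord_inj; rewrite !inordE => /perm_inj.
  by move/(congr1 val); rewrite /= !inordK.
pose h (x : cell m.+1) : cell m.+1 := (rev_ord x.1, x.2).
have hI : injective h.
  move=> [a b] [c d] [e ->]; suff -> : a = c by [].
  by apply: val_inj => /=; have := ltn_ord a; have := ltn_ord c; lia.
have SnE (i j : 'I_m.+1) : Sn (rev_ord i) j = ((i, j) \in S).
  by rewrite /Sn /row !inordE rev_ordK.
have cu r : r <= m.+1 -> chain_bound m.+1 Sn u r 0.
  move=> rm b s bm ss sA; rewrite min0n add0n addn0.
  have -> : rises u r b = dots w (m.+1 - r) b.
    rewrite rises_sum big_mkord (big_ord_widen m.+1 (fun j => nat_of_bool (u j < r))) //.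
    by apply: eq_bigr => j _; rewrite /u /row !inordE /= -[_ < r]/(_ <= _);
      have := ltn_ord (w j); lia.
  rewrite -(size_map (fun x => (row x.1, inord x.2) : cell m.+1)).
  have tm : all (fun x => (x.1 < m.+1) && (x.2 < m.+1)) s.
    by apply: sub_all sA => x; lia.
  apply: cS; rewrite ?leq_subr //.
    rewrite sorted_map; apply: (sub_in_sorted (P := fun x => (x.1 < m.+1) && (x.2 < m.+1))) ss => //.
    move=> x y /andP[x1 x2] /andP[y1 y2].
    by rewrite /climbs /descends /= !inordK; lia.
  rewrite all_map; apply/allP => x xs; have := allP sA x xs; have := allP tm x xs.
  by move=> /andP[x1 x2] /and4P[xS xr _ xb]; rewrite /= !inordK //; apply/and3P; split;
    [exact: xS|lia|exact: xb].
have := card_rothe_le ua un cu.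
have -> : \sum_(i < m.+1) \sum_(j < m.+1) ~~ Sn i j = m.+1 * m.+1 - #|S|.
  rewrite pair_big /= (reindex_inj hI) /=.
  have -> : m.+1 * m.+1 = #|{: cell m.+1}| by rewrite card_prod card_ord.
  rewrite -[S in RHS]finset.setCK -cardsCs -sum1_card [RHS]big_mkcond /=.
  apply: eq_bigr => -[i j] _; rewrite inE [Sn _ _](SnE i j).
  by case: (_ \in S).
have -> : #|rothe m.+1 m.+1 u| = #|diagram w|.
  rewrite -(card_preimset _ hI); apply: eq_card => -[i j]; rewrite !inE /=.
  rewrite /u /row !inordE /=; congr (_ && _).
    by have := ltn_ord i; have := ltn_ord (w j); lia.
  apply/forallP/idP => [H|H k].
    rewrite ltnNge; apply/negP => jw; have := H ((w^-1)%g i).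
    by rewrite jw !inordE permKV eqxx.
  apply/implyP => kj; rewrite !inordE; apply/eqP => e.
  suff : w k = i by move=> wk; move: H; rewrite -wk permK; lia.
  by apply: val_inj => /=; move: e; have := ltn_ord i; have := ltn_ord (w k); lia.
have : #|S| <= m.+1 * m.+1 by have := max_card S; rewrite card_prod card_ord.
lia.
Qed.

Lemma sorted_size_rows n (s : seq (cell n)) lo hi : sorted (@descends n) s ->
  all (fun x : cell n => lo <= x.1 < hi) s -> size s <= hi - lo.
Proof.
move=> ss sA; have : sorted ltn (map (fun x : cell n => val x.1) s).
  by rewrite sorted_map; apply: sub_sorted ss => x y /andP[].
rewrite ltn_sorted_uniq_leq => /andP[us _].
rewrite -(size_map (fun x : cell n => val x.1)) -(size_iota lo (hi - lo)).
by apply: uniq_leq_size us _ => _ /mapP[x /(allP sA) + ->]; rewrite mem_iota /=; lia.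
Qed.

Lemma sorted_size_cols n (s : seq (cell n)) lo hi : sorted (@descends n) s ->
  all (fun x : cell n => lo <= x.2 < hi) s -> size s <= hi - lo.
Proof.
move=> ss sA; have : sorted ltn (map (fun x : cell n => val x.2) s).
  by rewrite sorted_map; apply: sub_sorted ss => x y /andP[].
rewrite ltn_sorted_uniq_leq => /andP[us _].
rewrite -(size_map (fun x : cell n => val x.2)) -(size_iota lo (hi - lo)).
by apply: uniq_leq_size us _ => _ /mapP[x /(allP sA) + ->]; rewrite mem_iota /=; lia.
Qed.

(* Such a chain has too few rows available before the cell above the diagonal and too few
   columns after it. *)
Lemma chain_through_up n (w : 'S_n) (s : seq (cell n)) a b : b <= n ->
  sorted (@descends n) s -> all (fun x : cell n => (a <= x.1) && (x.2 < b)) s ->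
  has (mem (Dup n)) s -> size s <= dots w a b.
Proof.
move=> bn ss sA /hasP[x xs]; rewrite /= inE => xup.
case/splitPr: xs ss sA => s1 s2; rewrite sorted_pairwise; last exact: descends_trans.
rewrite pairwise_cat /= all_cat /= allrel_consr.
move=> /and4P[/andP[s1x _] s1s x2 s2s] /and3P[s1A /andP[xa xb] s2A].
rewrite size_cat /=.
have H1 : size s1 <= x.1 - a.
  apply: sorted_size_rows; first by rewrite sorted_pairwise //; exact: descends_trans.
  by apply/allP => y ys; have /andP[-> _] := allP s1A y ys; have /andP[] := allP s1x y ys.
have H2 : size s2 <= b - x.2.+1.
  apply: sorted_size_cols; first by rewrite sorted_pairwise //; exact: descends_trans.
  by apply/allP => y ys; have /andP[_ ->] := allP s2A y ys; have /andP[_] := allP x2 y ys;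
    rewrite andbT.
apply: leq_trans (leq_add H1 (_ : _ <= (b - x.2.+1).+1)) _; first by rewrite ltnS.
move: (dots_lower w a bn) xa xb xup; move: (dots w a b) (nat_of_ord x.1) (nat_of_ord x.2); lia.
Qed.

Section Counting.
Variables (n : nat) (w : 'S_n).

Lemma mem_SW_region (c x : cell n) : c \in Ess w -> c.1 <= x.1 -> x.2 < c.2.+1 -> x \in SW w.
Proof. by move=> cE c1 c2; rewrite inE; apply/exists_inP; exists c; rewrite ?c1. Qed.

(** All cells outside U can be added to S: one that lies in the region of an essential cell is above
    the diagonal, and chains through it are short. *)
Lemma card_chain_le_masked (S U : {set cell n}) : S \subset U -> U \subset SW w ->
  SW w :\: U \subset Dup n -> (forall c, c \in Ess w -> chain_le w S c.1 c.2.+1) ->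
  #|S| + #|diagram w| <= #|U|.
Proof.
move=> SU UW WU cS.
have cSU : forall c, c \in Ess w -> chain_le w (S :|: ~: U) c.1 c.2.+1.
  move=> c cE s ss sA; have [su|su] := boolP (has (mem (Dup n)) s).
    by apply: chain_through_up su => //; apply: sub_all sA => x /andP[].
  apply: cS => //; apply/allP => x xs; have /and3P[xSU xa xb] := allP sA x xs.
  rewrite xa xb !andbT; move: xSU; rewrite inE => /orP[//|]; rewrite inE => xU.
  case/hasP: su; exists x => //=; apply: (fintype.subsetP WU).
  by rewrite inE xU (mem_SW_region cE).
have := card_chain_le cSU; rewrite cardsU finset.disjoint_setI0 ?finset.cards0 ?subn0; last first.
  by rewrite finset.disjoints_subset finset.setCK.
have := cardsC U; rewrite card_prod card_ord; lia.
Qed.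

(** Ensures that the truncated difference [#|U| - #|diagram w|] is the true one. *)
Lemma card_diagram_le (U : {set cell n}) : U \subset SW w -> SW w :\: U \subset Dup n ->
  #|diagram w| <= #|U|.
Proof.
move=> UW WU; rewrite -[#|diagram w|]add0n -(finset.cards0 (cell n)).
apply: card_chain_le_masked => //; first exact: finset.sub0set.
by move=> c _ [|x s] //= _; rewrite inE.
Qed.
End Counting.

Import Order.TTheory GRing.Theory Num.Theory.
Local Open Scope ring_scope.

(** * Standard monomials and growth *)

Section StandardMonomials.
Variables (K : fieldType) (m : nat) (Z : ('I_m -> K) -> Prop).
Variables (lt : 'X_{1..m} -> 'X_{1..m} -> Prop) (Lead : 'X_{1..m} -> Prop).
Hypothesis lt_wf : well_founded lt.
Hypothesis Lead_red : forall l, Lead l -> exists q : {mpoly K[m]},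
  (forall v, Z v -> ('X_[l] : {mpoly K[m]}).@[v] = q.@[v]) /\
  (forall b, b \in msupp q -> (mdeg b <= mdeg l)%N /\ forall u, lt (b + u)%MM (l + u)%MM).

Definition standard (a : 'X_{1..m}) := forall l, Lead l -> ~~ (l <= a)%MM.

Definition reducible d (p : {mpoly K[m]}) := exists q : {mpoly K[m]},
  (forall v, Z v -> p.@[v] = q.@[v]) /\
  (forall b, b \in msupp q -> standard b /\ (mdeg b <= d)%N).

Lemma reducibleD d p q : reducible d p -> reducible d q -> reducible d (p + q).
Proof.
move=> [p' [pE pS]] [q' [qE qS]]; exists (p' + q'); split=> [v vZ|b].
  by rewrite !mevalD pE // qE.
by move/msuppD_le; rewrite mem_cat => /orP[/pS|/qS].
Qed.

Lemma reducible_sum d (p : {mpoly K[m]}) :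
  (forall b, b \in msupp p -> reducible d 'X_[b]) -> reducible d p.
Proof.
rewrite [p in reducible d p]mpolyE.
elim: (msupp p) => [_|b s IH H].
  by rewrite big_nil; exists 0; split=> // b; rewrite msupp0.
rewrite big_cons; apply: reducibleD; last first.
  by apply: IH => c cs; apply: H; rewrite inE cs orbT.
have [q [qE qS]] := H b (mem_head _ _).
exists (p@_b *: q); split=> [v vZ|c /msuppZ_le/qS //].
by rewrite !mevalZ qE.
Qed.

Lemma reducible_monomial a d : (mdeg a <= d)%N -> reducible d 'X_[a].
Proof.
elim/(well_founded_ind lt_wf): a => a IH ad.
have [st|] := pselect (standard a).
  by exists 'X_[a]; split=> // b; rewrite msuppX inE => /eqP ->.
move=> /existsNP[l /not_implyP[lL /negP]]; rewrite negbK => la.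
have [q [qE qS]] := Lead_red lL.
have aE : a = (l + (a - l))%MM by rewrite addmC submK.
have [|q' [q'E q'S]] := @reducible_sum d (q * 'X_[a - l]).
  move=> b /msuppM_le/allpairsP[[b1 b2] /= [b1q]].
  rewrite msuppX inE => /eqP -> ->; have [b1l b1lt] := qS _ b1q.
  apply: IH; first by rewrite [X in lt _ X]aE.
  by apply: leq_trans ad; rewrite [in leqRHS]aE !mdegD leq_add2r.
exists q'; split=> // v vZ.
by rewrite -q'E // mevalM -qE // aE mpolyXD mevalM -aE.
Qed.

Lemma reducible_deg d (p : {mpoly K[m]}) : (msize p <= d.+1)%N -> reducible d p.
Proof.
move=> pd; apply: reducible_sum => b /msize_mdeg_lt bp.
by apply: reducible_monomial; rewrite -ltnS; apply: leq_trans pd.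
Qed.

Variables (E s : nat).
Hypothesis standard_le : forall a, standard a -> (#|[set i | (E <= a i)%N]| <= s)%N.

Definition std_set d := [set b : 'X_{1..m < d.+1} | (#|[set i | (E <= b i)%N]| <= s)%N].

(** There are at most [2 ^ m] sets of positions for the large exponents, and for each of them at
    most [E.+1 ^ m] choices of the small exponents and [d.+1 ^ s] of the large ones. *)
Lemma card_std_set d : (#|std_set d| <= 2 ^ m * E.+1 ^ m * d.+1 ^ s)%N.
Proof.
pose F (B : {set 'I_m}) (i : 'I_m) : pred 'I_d.+1 := fun k => (i \in B) || (k < E)%N.
pose f (b : 'X_{1..m < d.+1}) : {ffun 'I_m -> 'I_d.+1} := [ffun i => inord (b i)].
have fE b i : f b i = b i :> nat.
  rewrite ffunE inordK // (leq_ltn_trans _ (bmdeg b)) // mdegE.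
  by rewrite (bigD1 i) //= leq_addr.
have fI : injective f.
  by move=> a b ab; apply: val_inj; apply/mnmP => i; rewrite -!fE ab.
rewrite -(card_imset _ fI).
pose U := \bigcup_(B : {set 'I_m} | (#|B| <= s)%N) [set g in family (F B)].
have sub : f @: std_set d \subset U.
  apply/fintype.subsetP => _ /imsetP[b + ->]; rewrite inE => bs.
  apply/bigcupP; exists [set i | (E <= b i)%N] => //.
  by rewrite inE; apply/familyP => i; rewrite unfold_in /F /= inE fE leqNgt orNb.
apply: leq_trans (subset_leq_card sub) _.
have UB : (#|U| <= \sum_(B : {set 'I_m} | (#|B| <= s)%N) #|family (F B)|)%N.
  rewrite /U; elim/big_rec2: _ => [|B x A _ H]; first by rewrite finset.cards0.
  by apply: leq_trans (leq_card_setU _ _) _; rewrite cardsE leq_add2l.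
apply: leq_trans UB _.
apply: leq_trans (_ : \sum_(B : {set 'I_m} | (#|B| <= s)%N) E.+1 ^ m * d.+1 ^ s <= _)%N.
  apply: leq_sum => B Bs; rewrite card_family foldrE big_map big_enum /=.
  rewrite (bigID (mem B)) /= mulnC leq_mul //.
    apply: leq_trans (_ : \prod_(i | i \notin B) E.+1 <= _)%N.
      apply: leq_prod => i iB; rewrite /F (negbTE iB) /=.
      apply: leq_trans (_ : #|[pred k : 'I_E.+1 | true]| <= _)%N; last by rewrite card_ord.
      pose g (k : 'I_d.+1) : 'I_E.+1 := inord k.
      rewrite -(card_in_image (f := g)) ?max_card // => k k' kE kE'.
      have {}kE : (k < E.+1)%N := leqW kE; have {}kE' : (k' < E.+1)%N := leqW kE'.
      by move/(congr1 val); rewrite /= !inordK // => /val_inj.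
    rewrite prod_nat_const leq_pexp2l //.
    by rewrite -[leqRHS]card_ord max_card.
  apply: leq_trans (_ : \prod_(i in B) d.+1 <= _)%N.
    by apply: leq_prod => i iB; rewrite -[leqRHS]card_ord max_card.
  by rewrite prod_nat_const leq_pexp2l.
rewrite sum_nat_const -mulnA leq_mul2r; apply/orP; right.
rewrite -[X in (2 ^ X)%N](card_ord m) -cardsT -card_powerset.
by apply: subset_leq_card; apply/fintype.subsetP => B _; rewrite powersetT inE.
Qed.

Lemma msize_prod_le e (F : 'I_e -> {mpoly K[m]}) (a : 'I_e -> nat) D M :
  (forall k, (msize (F k) <= D.+1)%N) -> (forall k, (a k <= M)%N) ->
  (msize (\prod_k F k ^+ a k) <= (e * (M * D)).+1)%N.
Proof.
move=> FD aM.
have mulD (p q : {mpoly K[m]}) i j : (msize p <= i.+1 -> msize q <= j.+1 ->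
    msize (p * q)%R <= (i + j).+1)%N.
  move=> pi qj; have [->|p0] := eqVneq p 0; first by rewrite mul0r msize0.
  have [->|q0] := eqVneq q 0; first by rewrite mulr0 msize0.
  by rewrite msizeM // -subn1 leq_subLR (leq_trans (leq_add pi qj)) // addSn addnS.
have powD k j : (msize (F k ^+ j) <= (j * D).+1)%N.
  elim: j => [|j IH]; first by rewrite expr0 msize1.
  by rewrite exprS mulSn; apply: mulD.
have -> : (e * (M * D) = \sum_(k < e) M * D)%N by rewrite sum_nat_const card_ord.
elim/big_rec2: _ => [|k i p _ H]; first by rewrite msize1.
by apply: mulD => //; apply: leq_trans (powD _ _) _; rewrite ltnS leq_mul2r aM orbT.
Qed.

Theorem dependent_of_standard e (F : 'I_e -> {mpoly K[m]}) : (s < e)%N ->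
  exists P : {mpoly K[e]}, P != 0 /\ forall v, Z v -> P.@[fun k => (F k).@[v]] = 0.
Proof.
move=> se; pose D := \max_k msize (F k).
have FD k : (msize (F k) <= D.+1)%N by apply: leqW; apply: leq_bigmax.
(* M is chosen so that [C * d.+1 ^ s <= M * M.+1 ^ s < M.+1 ^ s.+1 <= M.+1 ^ e]: the standard
   monomials of degree at most d are fewer than the products with exponents at most M. *)
pose C := (2 ^ m * E.+1 ^ m)%N.
pose M := (C * (e * D).+1 ^ s)%N; pose d := (e * (M * D))%N.
pose A := {ffun 'I_e -> 'I_M.+1}.
have /choice[q qP] (a : A) : reducible d (\prod_k F k ^+ a k).
  by apply/reducible_deg/msize_prod_le => // k; rewrite -ltnS.
have card_lt : (#|std_set d| < #|{: A}|)%N.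
  apply: leq_ltn_trans (card_std_set d) _; rewrite card_ffun !card_ord -/C.
  apply: leq_trans (_ : M.+1 ^ s.+1 <= _)%N; last by rewrite leq_pexp2l.
  rewrite expnS; apply: leq_ltn_trans (_ : M * M.+1 ^ s < _)%N; last first.
    by rewrite ltn_pmul2r ?expn_gt0.
  rewrite /M -mulnA -/M leq_mul2l -expnMn; apply/orP; right.
  have dM : (d.+1 <= (e * D).+1 * M.+1)%N by rewrite /d; nia.
  by case: (posnP s) => [->|s0]; rewrite ?expn0 // leq_exp2r.
pose mat : 'M[K]_(#|{: A}|, #|std_set d|) :=
  \matrix_(i < #|{: A}|, j < #|std_set d|) (q (enum_val i))@_(bmnm (enum_val j)).
have : kermx mat != 0.
  rewrite kermx_eq0 /row_free; apply/eqP => rk.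
  by have := rank_leq_col mat; rewrite rk leqNgt card_lt.
case/rowV0Pn => y /sub_kermxP ymat y0.
pose mon (a : A) := [multinom (a i : nat) | i < e].
have monI : injective mon.
  by move=> a b /mnmP ab; apply/ffunP => i; apply: val_inj; have := ab i; rewrite !mnmE.
pose P : {mpoly K[e]} := \sum_(i < #|{: A}|) y 0 i *: 'X_[mon (enum_val i)].
have PE i : P@_(mon (enum_val i)) = y 0 i.
  rewrite /P raddf_sum (bigD1 i) //= mcoeffZ mcoeffX eqxx mulr1 big1 ?addr0 // => j ji.
  by rewrite mcoeffZ mcoeffX (inj_eq monI) (inj_eq enum_val_inj) (negbTE ji) mulr0.
exists P; split.
  apply: contraNneq y0 => P0; apply/eqP/rowP => i.
  by rewrite -PE P0 mcoeff0 mxE.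
move=> v vZ; rewrite /P raddf_sum /=.
have qE a : (q a).@[v] = \sum_(j < #|std_set d|) (q a)@_(bmnm (enum_val j)) *
    ('X_[bmnm (enum_val j)] : {mpoly K[m]}).@[v].
  have [_ qS] := qP a.
  have qd : (msize (q a) <= d.+1)%N.
    rewrite msizeE; apply/bigmax_leqP_seq => b bq _; by have [] := qS b bq.
  rewrite {1}(mpolywE qd) raddf_sum /= (bigID (mem (std_set d))) /= [X in _ + X]big1 ?addr0.
    rewrite big_enum_val /=; apply: eq_bigr => j _; exact: mevalZ.
  move=> b; rewrite inE => bS; rewrite mevalZ; apply/eqP; rewrite mulf_eq0 mcoeff_eq0.
  by apply/orP; left; apply: contra bS => /qS[/standard_le].
transitivity (\sum_(i < #|{: A}|) y 0 i * (q (enum_val i)).@[v]).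
  apply: eq_bigr => i _; rewrite mevalZ mevalX; congr (_ * _).
  have [<- // _] := qP (enum_val i); rewrite rmorph_prod /=; apply: eq_bigr => k _.
  by rewrite mnmE rmorphXn.
under eq_bigr do rewrite qE mulr_sumr.
rewrite exchange_big /= big1 // => j _.
have /rowP/(_ j) := ymat; rewrite !mxE => yj.
rewrite -[RHS](mul0r (('X_[bmnm (enum_val j)] : {mpoly K[m]}).@[v])) -[in RHS]yj mulr_suml.
by apply: eq_bigr => i _; rewrite mxE mulrA.
Qed.

End StandardMonomials.

(** * Diagonal terms of minors *)

Local Open Scope nat_scope.

Section Rearrangement.
Variable k : nat.
Implicit Types (p : 'S_k) (f g : 'I_k -> nat).

Lemma increasing_ord_le (h : 'I_k -> 'I_k) : {homo h : i j / i < j} -> forall i : 'I_k, i <= h i.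
Proof.
move=> hi [i ik]; elim: i ik => // i IH ik.
apply: leq_ltn_trans (IH (ltnW ik)) _.
exact: hi.
Qed.

Lemma increasing_perm p : {homo p : i j / i < j} -> p = 1%g.
Proof.
move=> pI; have pV : {homo (p^-1)%g : i j / i < j}.
  move=> i j ij; rewrite ltnNge; apply/negP; rewrite leq_eqVlt => /orP[/eqP/val_inj/perm_inj|].
    by move=> ji; move: ij; rewrite ji ltnn.
  by move/pI; rewrite !permKV ltnNge (ltnW ij).
apply/permP => i; rewrite perm1; apply: val_inj; apply/eqP.
rewrite eqn_leq (increasing_ord_le pI) andbT.
by have := increasing_ord_le pV (p i); rewrite permK.
Qed.

(** Undoing an inversion strictly increases the sum, so the identity is the only permutation that
    attains the maximum. *)
Lemma rearrangement_lt p f g : {homo f : i j / i < j >-> i < j} ->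
  {homo g : i j / i < j >-> i < j} ->
  p != 1%g -> \sum_i f i * g (p i) < \sum_i f i * g i.
Proof.
move=> fI gI.
have step (q : 'S_k) : q != 1%g -> exists q' : 'S_k, \sum_i f i * g (q i) < \sum_i f i * g (q' i).
  move=> q1; have [i [j [ij qji]]] : exists i j : 'I_k, i < j /\ q j < q i.
    apply: contrapT => H; case/eqP: q1; apply: increasing_perm => i j ij.
    rewrite ltnNge leq_eqVlt negb_or; apply/andP; split.
      by apply/eqP => /val_inj/perm_inj ji; rewrite ji ltnn in ij.
    by apply/negP => qji; apply: H; exists i, j.
  exists (tperm i j * q)%g.
  have nij : j != i by rewrite -val_eqE /= gtn_eqF.
  rewrite (bigD1 i) // (bigD1 j) //= [ltnRHS](bigD1 i) // [X in _ < _ + X](bigD1 j) //=.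
  rewrite !permM tpermL tpermR.
  rewrite [X in _ < _ + (_ + X)](eq_bigr (fun i => f i * g (q i))); last first.
    by move=> l /andP[li lj]; rewrite permM tpermD // eq_sym.
  by rewrite !addnA ltn_add2r; have := fI _ _ ij; have := gI _ _ qji; nia.
pose F (q : 'S_k) := \sum_i f i * g (q i).
have [q _ qmax] := @arg_maxnP _ (1%g : 'S_k) predT F isT.
have -> : \sum_i f i * g i = F 1%g by apply: eq_bigr => i _; rewrite perm1.
have q1 : q = 1%g.
  by apply/eqP; apply: contraT => /step[q' H]; have : F q' <= F q := qmax q' isT;
    rewrite leqNgt /F H.
move=> /step[q' H]; apply: leq_trans H _; rewrite -q1; exact: qmax.
Qed.
End Rearrangement.

Local Open Scope ring_scope.

Section DiagonalTerms.
Variables (K : fieldType) (n : nat) (w : 'S_n).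
(* The entry in the cell c is carried by the coordinate tau c: tau is the identity, or for
   symmetric matrices the reflection into the lower triangle. *)
Variables (A : {set cell n}) (tau : cell n -> cell n) (N : nat).
Variable Z : ('I_#|{: cell n}| -> K) -> Prop.
Hypothesis cardA : forall S : {set cell n}, S \subset A ->
  (forall c, c \in Ess w -> chain_le w S c.1 c.2.+1) -> (#|S| <= N)%N.
Hypothesis ZA : forall v, Z v -> forall c, c \notin A -> v (enum_rank c) = 0.
Hypothesis tauA : forall c, c \in A -> tau c = c.
Hypothesis tauM : forall c, ((tau c).1 * (tau c).2 = c.1 * c.2)%N.
Hypothesis minorsZ : forall v, Z v -> forall c, c \in Ess w ->
  forall f g : 'I_(dots w c.1 c.2.+1).+1 -> 'I_n,
  (forall i, c.1 <= f i)%N -> (forall i, g i < c.2.+1)%N ->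
  \det (\matrix_(i, j) v (enum_rank (tau (f i, g j)))) = 0.

Let m := #|{: cell n}|.

(* A chain beats all other terms of its minor for the weight i * j of the cell (i, j), by the
   rearrangement inequality; this weight is invariant under transposition. *)
Definition ord_prod (c : cell n) : nat := (c.1 * c.2)%N.

Definition cell_weight (a : 'X_{1..m}) : nat :=
  \sum_i (ord_prod (enum_val i) * a i)%N.

Lemma cell_weightD a b : cell_weight (a + b)%MM = (cell_weight a + cell_weight b)%N.
Proof. by rewrite -big_split; apply: eq_bigr => i _; rewrite mnmDE mulnDr. Qed.

Lemma cell_weightU c : cell_weight U_(enum_rank c)%MM = (c.1 * c.2)%N.
Proof.
rewrite /cell_weight (bigD1 (enum_rank c)) //= mnm1E eqxx enum_rankK muln1 big1 ?addn0 //.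
by move=> i ic; rewrite mnm1E eq_sym (negbTE ic) muln0.
Qed.

Lemma cell_weight_sum k (x : 'I_k -> cell n) :
  cell_weight (\sum_i U_(enum_rank (x i)))%MM = (\sum_i (x i).1 * (x i).2)%N.
Proof.
rewrite (big_morph cell_weight cell_weightD (id1 := 0%N)); last first.
  by rewrite /cell_weight big1 // => i _; rewrite mnm0E muln0.
by apply: eq_bigr => i _; rewrite cell_weightU.
Qed.

Definition diagonal_lead (l : 'X_{1..m}) :=
  (exists2 c, c \notin A & l = U_(enum_rank c)%MM) \/
  (exists2 c, c \in Ess w & exists x : 'I_(dots w c.1 c.2.+1).+1 -> cell n,
    [/\ forall i, [&& x i \in A, (c.1 <= (x i).1)%N & ((x i).2 < c.2.+1)%N],
      forall i j : 'I_(dots w c.1 c.2.+1).+1, (i < j)%N -> descends (x i) (x j)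
      & l = (\sum_i U_(enum_rank (x i)))%MM]).

Lemma diagonal_lead_red l : diagonal_lead l -> exists q : {mpoly K[m]},
  (forall v, Z v -> ('X_[l] : {mpoly K[m]}).@[v] = q.@[v]) /\
  (forall b, b \in msupp q -> (mdeg b <= mdeg l)%N /\
     forall u, (cell_weight (b + u)%MM < cell_weight (l + u)%MM)%N).
Proof.
case=> [[c cA ->]|[c cE [x [xA xI ->]]]].
  exists 0; split=> [v vZ|b]; last by rewrite msupp0.
  by rewrite meval0 mevalXU ZA.
pose mon (p : 'S_(dots w c.1 c.2.+1).+1) : 'X_{1..m} :=
  (\sum_i U_(enum_rank (tau ((x i).1, (x (p i)).2))))%MM.
have tau_x i : tau ((x i).1, (x i).2) = x i.
  by rewrite -surjective_pairing tauA //; have /and3P[] := xA i.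
have mon1 : mon 1%g = (\sum_i U_(enum_rank (x i)))%MM.
  by apply: eq_bigr => i _; rewrite perm1 tau_x.
have mdeg_mon p : mdeg (mon p) = (dots w c.1 c.2.+1).+1.
  by rewrite mdeg_sum (eq_bigr (fun=> 1%N)) ?sum1_card ?card_ord // => i _; rewrite mdeg1.
have monE v p : ('X_[mon p] : {mpoly K[m]}).@[v] =
    \prod_i v (enum_rank (tau ((x i).1, (x (p i)).2))).
  pose ev (b : 'X_{1..m}) := ('X_[b] : {mpoly K[m]}).@[v].
  have evD b1 b2 : ev (b1 + b2)%MM = ev b1 * ev b2 by rewrite /ev mpolyXD mevalM.
  have ev0 : ev 0%MM = 1 by rewrite /ev mpolyX0 meval1.
  rewrite -/(ev _) (big_morph ev evD ev0); apply: eq_bigr => i _; exact: mevalXU.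
(* The remaining terms of a vanishing determinant. [tau] fixes the diagonal entries, which lie in A,
   and preserves the weights of all others. *)
exists (- \sum_(p : 'S_(dots w c.1 c.2.+1).+1 | p != 1%g) (-1) ^+ p *: 'X_[mon p]);
  split=> [v vZ|b].
  have fA i : (c.1 <= (x i).1)%N by have /and3P[] := xA i.
  have gA i : ((x i).2 < c.2.+1)%N by have /and3P[] := xA i.
  have := minorsZ vZ cE fA gA; rewrite /determinant.
  rewrite (eq_bigr (fun p : 'S_(dots w c.1 c.2.+1).+1 => (-1) ^+ p * ('X_[mon p] : {mpoly K[m]}).@[v])); last first.
    by move=> p _; rewrite monE; congr (_ * _); apply: eq_bigr => i _; rewrite mxE.
  rewrite (bigD1 1%g) //= odd_perm1 expr0 mul1r mon1 mevalN => /eqP.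
  rewrite addr_eq0 => /eqP ->; congr (- _); rewrite raddf_sum /=.
  by apply: eq_bigr => p _; rewrite mevalZ.
rewrite (perm_mem (msuppN _)) => /msupp_sum_le/flattenP[_ /mapP[p + ->]].
rewrite mem_filter => /andP[p1 _] /msuppZ_le; rewrite msuppX inE => /eqP ->.
rewrite -mon1 !mdeg_mon; split=> // u; rewrite !cell_weightD ltn_add2r mon1 !cell_weight_sum.
under eq_bigr do rewrite tauM /=.
apply: rearrangement_lt p1 => i j ij; by have /andP[] := xI i j ij.
Qed.

(** The support of a standard monomial lies in A and has no long chain, since the product over such
    a chain would be a leading monomial dividing it. *)
Lemma standard_diagonal a : standard diagonal_lead a ->
  (#|[set i | (1 <= a i)%N]| <= N)%N.
Proof.
move=> sa; pose S : {set cell n} := [set c | (0 < a (enum_rank c))%N].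
have -> : #|[set i | (1 <= a i)%N]| = #|S|.
  rewrite -[RHS](card_imset _ (@enum_rank_inj _)); apply: eq_card => i; rewrite inE.
  apply/idP/imsetP => [ai|[c]]; last by rewrite inE => ? ->.
  by exists (enum_val i); rewrite ?inE enum_valK.
apply: cardA => [|c cE s ss sS].
  apply/fintype.subsetP => c; rewrite inE lt0n -lep1mP => ca; apply: contraLR ca => cA.
  by apply: (sa); left; exists c.
rewrite leqNgt; apply/negP => cs.
have ltns (i : 'I_(dots w c.1 c.2.+1).+1) : (i < size s)%N by apply: leq_trans cs.
pose x (i : 'I_(dots w c.1 c.2.+1).+1) := tnth (in_tuple s) (Ordinal (ltns i)).
have xs i : x i \in s by apply: mem_tnth.
have xI (i j : 'I_(dots w c.1 c.2.+1).+1) : (i < j)%N -> descends (x i) (x j).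
  rewrite /x !(tnth_nth (x ord0)) /= => ij.
  by apply: (sorted_ltn_nth (@descends_trans n)) => //; rewrite inE.
have xinj : injective x.
  move=> i j xij; case: (ltngtP i j) => [/xI|/xI|/val_inj //].
    by rewrite xij /descends ltnn.
  by rewrite xij /descends ltnn.
have /negP[] : ~~ ((\sum_i U_(enum_rank (x i)))%MM <= a)%MM.
  apply: (sa); right; exists c => //; exists x; split=> // i.
  have /and3P[xS -> ->] := allP sS _ (xs i); rewrite !andbT.
  move: xS; rewrite inE lt0n -lep1mP => ca; apply: contraLR ca => cA.
  by apply: (sa); left; exists (x i).
apply/mnm_lepP => j; rewrite mnm_sumE.
have [[i xi]|nx] := pselect (exists i, enum_rank (x i) = j).
  rewrite (bigD1 i) //= mnm1E xi eqxx big1 => [|i' i'i].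
    by have /and3P[] := allP sS _ (xs i); rewrite inE xi.
  by rewrite mnm1E -xi (inj_eq enum_rank_inj) (inj_eq xinj) (negbTE i'i).
rewrite big1 // => i _; rewrite mnm1E; case: eqP => // xi; case: nx; by exists i.
Qed.

Lemma cell_weight_wf : well_founded (fun a b => (cell_weight a < cell_weight b)%N).
Proof.
move=> a; have [k] := ubnP (cell_weight a); elim: k a => [a|k IH a]; first by rewrite ltn0.
rewrite ltnS => ak; constructor=> b ba; apply: IH; exact: leq_trans ba ak.
Qed.

Theorem dependent_of_diagonal e (F : 'I_e -> {mpoly K[m]}) : (N < e)%N ->
  exists P : {mpoly K[e]}, P != 0 /\ forall v, Z v -> P.@[fun k => (F k).@[v]] = 0.
Proof.
exact: (@dependent_of_standard K m Z (fun a b => (cell_weight a < cell_weight b)%N)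
  diagonal_lead cell_weight_wf diagonal_lead_red 1%N N standard_diagonal e F).
Qed.
End DiagonalTerms.

(** * Selecting independent coordinates *)

Section PushMonomials.
Variables (K : fieldType) (N m : nat) (s : 'I_N -> 'I_m).
Hypothesis sI : injective s.

Definition push_mnm (b : 'X_{1..N}) : 'X_{1..m} := (\sum_k U_(s k) *+ b k)%MM.

Lemma push_mnmE b k : push_mnm b (s k) = b k.
Proof.
rewrite mnm_sumE (bigD1 k) //= mulmnE mnm1E eqxx mul1n big1 ?addn0 // => l lk.
by rewrite mulmnE mnm1E (inj_eq sI) (negbTE lk).
Qed.

Lemma push_mnm_out b i : (forall k, s k != i) -> push_mnm b i = 0%N.
Proof. by move=> si; rewrite mnm_sumE big1 // => k _; rewrite mulmnE mnm1E (negbTE (si k)). Qed.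

Lemma push_mnm_inj : injective push_mnm.
Proof. by move=> a b ab; apply/mnmP => k; rewrite -!push_mnmE ab. Qed.

Definition push_mpoly (P : {mpoly K[N]}) : {mpoly K[m]} :=
  \sum_(b <- msupp P) P@_b *: 'X_[push_mnm b].

Lemma push_mpoly_eval P v : (push_mpoly P).@[v] = P.@[fun k => v (s k)].
Proof.
pose ev (b : 'X_{1..m}) := ('X_[b] : {mpoly K[m]}).@[v].
have evD b1 b2 : ev (b1 + b2)%MM = ev b1 * ev b2 by rewrite /ev mpolyXD mevalM.
have ev0 : ev 0%MM = 1 by rewrite /ev mpolyX0 meval1.
rewrite [in RHS](mpolyE P) !raddf_sum /=; apply: eq_bigr => b _.
rewrite !mevalZ [in RHS]mevalX -/(ev _) (big_morph ev evD ev0); congr (_ * _).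
by apply: eq_bigr => k _; rewrite /ev -mpolyXn rmorphXn /= mevalXU.
Qed.

Lemma push_mpoly_coef P b : (push_mpoly P)@_(push_mnm b) = P@_b.
Proof.
transitivity ((\sum_(a <- msupp P) P@_a *: 'X_[a])@_b); last by rewrite -mpolyE.
rewrite !raddf_sum /=.
by apply: eq_bigr => a _; rewrite !mcoeffZ !mcoeffX (inj_eq push_mnm_inj).
Qed.

Lemma push_mpoly_neq0 P : P != 0 -> push_mpoly P != 0.
Proof.
apply: contra_neq => P0; apply/mpolyP => b.
by rewrite -push_mpoly_coef P0 !mcoeff0.
Qed.

Lemma push_mpoly_supp P a : a \in msupp (push_mpoly P) -> exists b, a = push_mnm b.
Proof.
move=> /msupp_sum_le/flattenP[_ /mapP[b + ->]].
by move=> _ /msuppZ_le; rewrite msuppX inE => /eqP ->; exists b.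
Qed.

End PushMonomials.

Section IndependentCoordinates.
Variables (K : fieldType) (m e N : nat) (T : ('I_m -> K) -> Prop).
Variables (A B : {set 'I_m}) (G : 'I_e -> {mpoly K[m]}).
Hypothesis TB : forall v, T v -> forall i, i \in B -> v i = 0.
Hypothesis G_indep : forall P : {mpoly K[e]}, P != 0 ->
  exists2 v, T v & P.@[fun k => (G k).@[v]] != 0.
Hypothesis Ne : (N + #|~: (A :|: B)| <= e)%N.

(* If any N coordinates in A were dependent, the leading monomials of the relations would
   leave too few standard monomials for the independent functions G. *)
Lemma indep_coordinates : exists s : 'I_N -> 'I_m, [/\ injective s, forall k, s k \in A &
  forall P : {mpoly K[N]}, (forall v, T v -> P.@[fun k => v (s k)] = 0) -> P = 0].
Proof.
have [N0|N_gt0] := posnP N.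
  have s0 : 'I_N -> 'I_m by case; rewrite N0.
  exists s0; split=> [[k kN]|[k kN]|P PT]; do ?by exfalso; rewrite N0 in kN.
  (* The constant polynomial 1 provides a point of T. *)
  have [v vT _] := G_indep (oner_neq0 _).
  have PC : P = (P@_0)%:MP.
    apply: msize1_polyC; rewrite msizeE; apply/bigmax_leqP_seq => b _ _.
    by rewrite ltnS leqn0 mdegE big1 // => -[k kN]; exfalso; rewrite N0 in kN.
  by have := PT v vT; rewrite PC mevalC => ->; rewrite mpolyC0.
apply: contrapT => Hno.
pose good (s : {ffun 'I_N -> 'I_m}) := injective s /\ forall k, s k \in A.
have /choice[Q QP] (s : {ffun 'I_N -> 'I_m}) : exists P : {mpoly K[N]}, good s ->
    P != 0 /\ forall v, T v -> P.@[fun k => v (s k)] = 0.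
  have [[sI sA]|ng] := pselect (good s); last by exists 0.
  apply: contrapT => Hs; apply: Hno; exists s; split=> // P PT.
  by apply/eqP; apply: contraT => P0; case: Hs; exists P.
pose q (s : {ffun 'I_N -> 'I_m}) := push_mpoly s (Q s).
(* E exceeds every exponent of every leading monomial, so a monomial with N exponents of at least E
   on A is divisible by some [mlead (q s)]. *)
pose E := (\max_(s : {ffun 'I_N -> 'I_m}) msize (q s)).+1.
pose Lead (l : 'X_{1..m}) := (exists2 i, i \in B & l = U_(i)%MM) \/
  (exists2 s, good s & l = mlead (q s)).
have red l : Lead l -> exists p : {mpoly K[m]},
    (forall v, T v -> ('X_[l] : {mpoly K[m]}).@[v] = p.@[v]) /\
    (forall b, b \in msupp p -> (mdeg b <= mdeg l)%N /\
      forall u, ((b + u)%MM < (l + u)%MM)%O).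
  case=> [[i iB ->]|[s gs ->]].
    exists 0; split=> [v vT|b]; last by rewrite msupp0.
    by rewrite meval0 mevalXU TB.
  have [Q0 QT] := QP s gs; have q0 : q s != 0 by apply: push_mpoly_neq0 Q0; case: gs.
  have lc0 : mleadc (q s) != 0 by rewrite mleadc_eq0.
  exists ('X_[mlead (q s)] - (mleadc (q s))^-1 *: q s); split=> [v vT|b].
    by rewrite mevalB mevalZ push_mpoly_eval QT // mulr0 subr0.
  rewrite mcoeff_msupp mcoeffB mcoeffZ mcoeffX => bn0.
  have bl : (b < mlead (q s))%O.
    have bl : b != mlead (q s).
      by apply: contraNneq bn0 => ->; rewrite eqxx mulVf // subrr.
    rewrite lt_neqAle bl; apply: msupp_le_mlead; rewrite mcoeff_msupp.
    by move: bn0; rewrite [_ == b]eq_sym (negbTE bl) sub0r oppr_eq0 mulf_eq0 negb_or => /andP[].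
  by split=> [|u]; [apply/lemc_mdeg/ltW|rewrite ltmc_add2l].
have std a : standard Lead a -> (#|[set i | (E <= a i)%N]| <= N.-1 + #|~: (A :|: B)|)%N.
  move=> sa; pose S := [set i | (E <= a i)%N].
  have SB : [disjoint S & B].
    apply/pred0P => i /=; apply/negP => /andP[]; rewrite inE => ai iB.
    have /negP[] : ~~ (U_(i) <= a)%MM by apply: (sa); left; exists i.
    by rewrite lep1mP -lt0n (leq_trans _ ai).
  have SA : (#|S :&: A| <= N.-1)%N.
    rewrite -ltnS prednK // ltnNge; apply/negP => NS.
    pose s := [ffun k : 'I_N => enum_val (widen_ord NS k)].
    have sSA k : s k \in S :&: A by rewrite ffunE enum_valP.
    have gs : good s.
      split=> [k l|k]; last by have := sSA k; rewrite inE => /andP[].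
      by rewrite !ffunE => /enum_val_inj/(congr1 val) /= /val_inj.
    have /negP[] : ~~ (mlead (q s) <= a)%MM by apply: (sa); right; exists s.
    have [Q0 QT] := QP s gs; have q0 : q s != 0 by apply: push_mpoly_neq0 Q0; case: gs.
    have [b bE] := push_mpoly_supp (mlead_supp q0).
    apply/mnm_lepP => i; have [[k ki]|ni] := pselect (exists k, s k = i).
      have := sSA k; rewrite ki inE => /andP[]; rewrite inE => Ea _.
      apply: leq_trans Ea; apply: leq_trans (_ : mdeg (mlead (q s)) <= _)%N.
        by rewrite mdegE (bigD1 i) //= leq_addr.
      by apply: ltnW; rewrite mlead_deg // leqW // (leq_bigmax (F := fun s => msize (q s))).
    by rewrite bE push_mnm_out // => k; apply/eqP => ki; case: ni; exists k.
  rewrite -/S -(cardsID A S) leq_add //; apply: subset_leq_card.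
  apply/fintype.subsetP => i; rewrite !inE => /andP[iA iS]; rewrite negb_or iA.
  by move/pred0P: SB => /(_ i) /=; rewrite inE iS => /negbT.
have se : (N.-1 + #|~: (A :|: B)| < e)%N by apply: leq_trans Ne; rewrite -addSn prednK.
have [P [P0 PT]] := dependent_of_standard (@ltom_wf m) red std G se.
by have [v vT] := G_indep P0; rewrite PT // eqxx.
Qed.
End IndependentCoordinates.

(** * Nonvanishing of polynomials under triangular substitutions *)

Lemma poly_nonroot (K : numFieldType) (p : {poly K}) : p != 0 -> exists x, p.[x] != 0.
Proof.
move=> p0; apply: contrapT => /forallNP H.
have := @max_poly_roots K p [seq i%:R | i <- iota 0 (size p)] p0.
rewrite size_map size_iota ltnn => F; apply/notF/F.
  by apply/allP => x _; rewrite /root; apply: contraT => /H.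
rewrite map_inj_uniq ?iota_uniq // => i j /eqP.
by rewrite eqr_nat => /eqP.
Qed.

Section Uni.
Variables (K : fieldType) (n : nat).
Implicit Type P : {mpoly K[n.+1]}.

Definition ord_extend (T : Type) (v : 'I_n -> T) (x : T) (i : 'I_n.+1) : T :=
  if unlift ord_max i is Some j then v j else x.

Lemma ord_extend_max T (v : 'I_n -> T) x : ord_extend v x ord_max = x.
Proof. by rewrite /ord_extend unlift_none. Qed.

Lemma ord_extend_widen T (v : 'I_n -> T) x i :
  ord_extend v x (widen_ord (leqnSn n) i) = v i.
Proof.
rewrite /ord_extend; have -> : widen_ord (leqnSn n) i = lift ord_max i.
  by apply: val_inj; rewrite /= /bump leqNgt ltn_ord.
by rewrite liftK.
Qed.

Lemma muni_eval P (v : 'I_n.+1 -> K) :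
  (map_poly (meval (fun i => v (widen_ord (leqnSn n) i))) (muni P)).[v ord_max] = P.@[v].
Proof.
rewrite mevalE muniE !raddf_sum /= horner_sum; apply: eq_bigr => m _.
rewrite -mul_polyC rmorphM /= map_polyC /= map_polyXn hornerM hornerC hornerXn.
rewrite mevalZ mevalX big_ord_recr /= mulrA; congr (_ * _ * _).
by apply: eq_bigr => i _; rewrite mnmE.
Qed.

Lemma muni_neq0 P : P != 0 -> muni P != 0.
Proof.
apply: contra_neq => mP0; apply/mpolyP => m; rewrite mcoeff0.
pose r (m : 'X_{1..n.+1}) := [multinom (m (widen_ord (leqnSn n) i)) | i < n].
transitivity (((muni P)`_(m ord_max))@_(r m)); last by rewrite mP0 coef0 mcoeff0.
rewrite muniE coef_sum raddf_sum /= [in LHS](mpolyE P) raddf_sum /=.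
apply: eq_bigr => a _; rewrite coefZ coefXn mulr_natr mcoeffMn !mcoeffZ !mcoeffX -[(_ * _) *+ _]mulr_natr -mulrA; congr (_ * _).
rewrite -/(r a) -natrM mulnb; congr (_%:R); congr (nat_of_bool _).
apply/eqP/andP => [->|[/eqP ra /eqP am]]; first by rewrite !eqxx.
apply/mnmP => i; have [->//|im] := eqVneq i ord_max.
have ii : (i < n)%N by rewrite ltn_neqAle -ltnS ltn_ord andbT; move: im; rewrite -val_eqE.
have -> : i = widen_ord (leqnSn n) (Ordinal ii) by apply: val_inj.
by move/mnmP: ra => /(_ (Ordinal ii)); rewrite !mnmE.
Qed.
End Uni.

(* The z_k are chosen one after the other; each has to avoid the roots of one univariate
   polynomial. *)
Lemma triangular_nonvanishing (K : numFieldType) e (phi u g : 'I_e -> ('I_e -> K) -> K) :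
  (forall (k : 'I_e) (z z' : 'I_e -> K), (forall j : 'I_e, (j < k)%N -> z j = z' j) ->
    u k z = u k z' /\ g k z = g k z') ->
  (forall k z, (forall j, z j != 0) -> u k z != 0) ->
  (forall k z, phi k z = z k * u k z + g k z) ->
  forall P : {mpoly K[e]}, P != 0 ->
  exists2 z, forall j, z j != 0 & P.@[fun k => phi k z] != 0.
Proof.
elim: e phi u g => [|e IH] phi u g dep u0 phiE P P0.
  exists (fun=> 1) => [[]//|]; apply: contraNneq P0 => PE.
  have PC : P = (P@_0)%:MP.
    apply: msize1_polyC; rewrite msizeE; apply/bigmax_leqP_seq => b _ _.
    by rewrite ltnS leqn0 mdegE big_ord0.
  by move: PE; rewrite PC mevalC => ->; rewrite mpolyC0.
pose W := widen_ord (leqnSn e).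
pose ext z := @ord_extend e K z 1.
(* The induction applies to the leading coefficient in the last variable. The value 1 that [ext]
   gives this variable is arbitrary but nonzero; the earlier functions do not depend on it. *)
have [||| |z z0 Pz] := IH (fun k z => phi (W k) (ext z)) (fun k z => u (W k) (ext z))
    (fun k z => g (W k) (ext z)) _ _ _ (lead_coef (muni P)).
- move=> k z z' zz; apply: dep => j jk.
  have je : (j < e)%N := ltn_trans jk (ltn_ord k).
  have -> : j = W (Ordinal je) by apply: ord_inj.
  by rewrite /ext /W !ord_extend_widen; apply: zz.
- move=> k z z0; apply: u0 => j; rewrite /ext /ord_extend.
  by case: unliftP => *; [apply: z0|apply: oner_neq0].
- by move=> k z; rewrite phiE /ext /W !ord_extend_widen.
- by rewrite lead_coef_eq0 muni_neq0.
pose r := map_poly (meval (fun k => phi (W k) (ext z))) (muni P).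
have r0 : r != 0.
  apply: contraNneq Pz => r0; have := coef_map (meval (fun k => phi (W k) (ext z))) (muni P) (size (muni P)).-1.
  by rewrite -/r r0 coef0 /= => <-.
pose a := u ord_max (ext z); pose b := g ord_max (ext z).
have a0 : a != 0.
  apply: u0 => j; rewrite /ext /ord_extend.
  by case: unliftP => *; [apply: z0|apply: oner_neq0].
(* The factor 'X forces x itself to be nonzero. *)
have [x] : exists x, ('X * (r \Po (a *: 'X + b%:P))).[x] != 0.
  apply: poly_nonroot; rewrite mulf_neq0 ?polyX_eq0 // -size_poly_gt0 size_comp_poly2.
    by rewrite size_poly_gt0.
  by rewrite size_polyDl size_scale // size_polyX // ltnS size_polyC leq_b1.
rewrite hornerM hornerX mulf_eq0 negb_or horner_comp !hornerE => /andP[x0 rx].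
exists (ord_extend z x) => [j|].
  by rewrite /ord_extend; case: unliftP => *; [apply: z0|].
rewrite -muni_eval phiE ord_extend_max.
have [-> ->] : u ord_max (ord_extend z x) = a /\ g ord_max (ord_extend z x) = b.
  apply: dep => j je; have -> : j = W (Ordinal je) by apply: ord_inj.
  by rewrite /ext /W !ord_extend_widen.
rewrite [x * a]mulrC (_ : map_poly _ _ = r) //.
apply: eq_map_poly => p; apply: meval_eq => k; rewrite !phiE /ext /W !ord_extend_widen.
have [-> ->] // : u (W k) (ord_extend z x) = u (W k) (ext z) /\ g (W k) (ord_extend z x) = g (W k) (ext z).
apply: dep => j jk; have je : (j < e)%N := ltn_trans jk (ltn_ord k).
have -> : j = W (Ordinal je) by apply: ord_inj.
by rewrite /ext /W !ord_extend_widen.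
Qed.

(** * Coordinates on BwB *)

Section CellOrder.
Variables (n : nat).

(* The elimination order: in the parametrization of BwB below, the entry of a cell outside the
   diagram is linear in the parameter of that cell, with coefficients depending only on the
   parameters of cells with smaller keys. *)
Definition cell_key (c : cell n) : nat := (c.2 * n + (n - c.1.+1))%N.

Lemma cell_key_col (a b i j : 'I_n) : (i < j)%N -> (cell_key (a, i) < cell_key (b, j))%N.
Proof. by rewrite /cell_key /=; have := ltn_ord a; nia. Qed.

Lemma cell_key_row (a b j : 'I_n) : (a < b)%N -> (cell_key (b, j) < cell_key (a, j))%N.
Proof. by rewrite /cell_key /=; have := ltn_ord b; lia. Qed.

Lemma cell_enumeration (D : {set cell n}) : exists p : 'I_#|D| -> cell n,
  [/\ injective p, forall k, p k \in D, forall c, c \in D -> exists k, p k = c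
    & forall j k, (cell_key (p j) < cell_key (p k))%N -> (j < k)%N].
Proof.
pose s := sort (relpre cell_key leq) (enum D).
have ss : size s = #|D| by rewrite size_sort cardE.
have srt : sorted leq (map cell_key s).
  by rewrite sorted_map; apply: sort_sorted => x y; apply: leq_total.
have us : uniq s by rewrite sort_uniq enum_uniq.
have lts (k : 'I_#|D|) : (k < size s)%N by rewrite ss.
pose p k := tnth (in_tuple s) (Ordinal (lts k)).
have pI : injective p.
  move=> j k; rewrite /p !(tnth_nth (p j)) /= => /eqP; rewrite nth_uniq ?lts // => /eqP.
  exact: val_inj.
exists p; split=> // [k|c cD|j k].
- by have := mem_tnth (Ordinal (lts k)) (in_tuple s); rewrite mem_sort mem_enum.
- have cs : c \in s by rewrite mem_sort mem_enum.
  have ci : (index c s < #|D|)%N by rewrite -ss index_mem.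
  by exists (Ordinal ci); rewrite /p (tnth_nth c) /= nth_index.
apply: contraTT; rewrite -!leqNgt leq_eqVlt => /orP[/eqP/val_inj -> //|kj].
rewrite /p !(tnth_nth (p j)) /= -!(nth_map (p j) 0%N) ?lts //.
by apply: (sorted_leq_nth leq_trans leqnn) => //; rewrite ?inE ?size_map ?lts // ltnW.
Qed.
End CellOrder.

Lemma mulmx_permutation (K : fieldType) n (w : 'S_n) (A : 'M[K]_n) i j :
  (A *m permutation_matrix K w) i j = A i (w j).
Proof.
rewrite mxE (bigD1 (w j)) //= mxE eqxx mulr1 big1 ?addr0 // => k kj.
by rewrite mxE (negbTE kj) mulr0.
Qed.

Section BorelCell.
Variables (K : numFieldType) (n : nat) (w : 'S_n).

Let D := ~: diagram w.
Let e := #|D|.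
Variable p : 'I_e -> cell n.
Hypothesis pI : injective p.
Hypothesis pD : forall k, p k \in D.
Hypothesis Dp : forall c, c \in D -> exists k, p k = c.
Hypothesis p_lt : forall j k, (cell_key (p j) < cell_key (p k))%N -> (j < k)%N.
Implicit Types (z : 'I_e -> K) (i j l : 'I_n).

Definition param z (c : cell n) : K := if [pick k | p k == c] is Some k then z k else 1.

(** With [right_param] this is the Bruhat normal form: outside the diagram, the cells weakly above
    the dot of their column parametrize the left factor, and those below it, which lie right of the
    dot of their row, parametrize the unitriangular right factor. *)
Definition left_param z i l : K := if (i <= w l)%N then param z (i, l) else 0.

Definition right_param z l j : K :=
  if l == j then 1 else if (l < j)%N && (w j < w l)%N then param z (w l, j) else 0.

Lemma param_p z k : param z (p k) = z k.
Proof.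
by rewrite /param; case: pickP => [k' /eqP/pI -> //|/(_ k)]; rewrite eqxx.
Qed.

Lemma param_neq0 z c : (forall k, z k != 0) -> param z c != 0.
Proof. by move=> z0; rewrite /param; case: pickP => [k _|_] //; apply: oner_neq0. Qed.

Lemma notin_diagram i j : (i, j) \in D = (i <= w j)%N || ((w^-1)%g i <= j)%N.
Proof. by rewrite !inE negb_and -!leqNgt. Qed.

Lemma param_eq z z' (k : 'I_e) c : (forall j : 'I_e, (j < k)%N -> z j = z' j) -> c \in D ->
  (cell_key c < cell_key (p k))%N -> param z c = param z' c.
Proof. by move=> zz /Dp[j <-] /p_lt/zz; rewrite !param_p. Qed.

(** For c outside the diagram, the index of the summand of the product entry at c that contains the
    parameter of c itself. *)
Definition pivot_col (c : cell n) : 'I_n := if (c.1 <= w c.2)%N then c.2 else (w^-1)%g c.1.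

Lemma nonvanishing_cells (P : {mpoly K[e]}) : P != 0 -> exists2 z : 'I_e -> K,
  forall k, z k != 0 &
  P.@[fun k => \sum_l left_param z (p k).1 l * right_param z l (p k).2] != 0.
Proof.
apply: (triangular_nonvanishing
  (u := fun k z => if ((p k).1 <= w (p k).2)%N then 1 else param z ((p k).1, (w^-1)%g (p k).1))
  (g := fun k z => \sum_(l | l != pivot_col (p k))
    left_param z (p k).1 l * right_param z l (p k).2)) => [k z z' zz|k z z0|k z].
- have := pD k; have zk := param_eq zz; move: zk; rewrite /pivot_col.
  case: (p k) => [i j] /= zk; rewrite notin_diagram.
  have [ij _|ji /= wij] := leqP i (w j).
    split=> //; apply: eq_bigr => l lj; rewrite /left_param /right_param (negbTE lj).
    have [il|_] := leqP i (w l); last by rewrite !mul0r.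
    have [/andP[lj' wjl]|_] := boolP ((l < j)%N && (w j < w l)%N); last by rewrite !mulr0.
    congr (_ * _); apply: zk; rewrite ?notin_diagram ?il //; first exact: cell_key_col.
      by rewrite permK (ltnW lj') orbT.
    exact/cell_key_row/(leq_ltn_trans ij).
  have wijlt : ((w^-1)%g i < j)%N.
    rewrite ltn_neqAle wij andbT; apply: contraTneq ji => /val_inj <-.
    by rewrite permKV ltnn.
  split.
    by apply: zk; [rewrite notin_diagram leqnn orbT|apply: cell_key_col].
  apply: eq_bigr => l lj; rewrite /left_param /right_param.
  have [il|_] := leqP i (w l); last by rewrite !mul0r.
  have [lj2|_] := eqVneq l j; first by rewrite lj2 leqNgt ji in il.
  have [/andP[lj' wjl]|_] := boolP ((l < j)%N && (w j < w l)%N); last by rewrite !mulr0.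
  congr (_ * _); apply: zk; rewrite ?notin_diagram ?il //; first exact: cell_key_col.
    by rewrite permK (ltnW lj') orbT.
  apply: cell_key_row; rewrite ltn_neqAle il andbT.
  by apply: contraNneq lj => /val_inj ->; rewrite permK.
- by case: ifP => _; [apply: oner_neq0|apply: param_neq0].
rewrite (bigD1 (pivot_col (p k))) //=; congr (_ + _).
have := pD k; have := param_p z k; rewrite /pivot_col /left_param /right_param.
case: (p k) => [i j] /= <-; rewrite notin_diagram; have [ij _|ji /= wij] := leqP i (w j).
  by rewrite ij eqxx.
have wijlt : ((w^-1)%g i < j)%N.
  rewrite ltn_neqAle wij andbT; apply: contraTneq ji => /val_inj <-.
  by rewrite permKV ltnn.
rewrite permKV leqnn wijlt ji /= -val_eqE /= (ltn_eqF wijlt) mulrC //.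
Qed.

Definition left_mx z : 'M[K]_n := \matrix_(i, l) left_param z i ((w^-1)%g l).
Definition right_mx z : 'M[K]_n := \matrix_(l, j) right_param z l j.

Lemma borel_left z : (forall k, z k != 0) -> borel (left_mx z).
Proof.
move=> z0; have T : is_trig_mx (left_mx z)^T.
  by apply/is_trig_mxP => i j ij; rewrite !mxE /left_param permKV leqNgt ij.
rewrite /borel /= T andbT -unitmx_tr unitmxE det_trig // unitfE.
apply/prodf_neq0 => i _; rewrite !mxE /left_param permKV leqnn; exact: param_neq0.
Qed.

Lemma borel_right z : borel (right_mx z).
Proof.
have T : is_trig_mx (right_mx z)^T.
  apply/is_trig_mxP => i j ij; rewrite !mxE /right_param -val_eqE /= gtn_eqF //.
  by rewrite ltnNge (ltnW ij).
rewrite /borel /= T andbT -unitmx_tr unitmxE det_trig // unitfE.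
by apply/prodf_neq0 => i _; rewrite !mxE /right_param eqxx oner_neq0.
Qed.

Lemma param_product z i j : (left_mx z *m permutation_matrix K w *m right_mx z) i j =
  \sum_l left_param z i l * right_param z l j.
Proof.
rewrite mxE; apply: eq_bigr => l _; rewrite mulmx_permutation !mxE permK //.
Qed.
End BorelCell.

(* By Gauss elimination the cells outside the diagram are free coordinates on BwB. *)
Lemma BwB_nonvanishing (K : numFieldType) n (w : 'S_n) :
  exists p : 'I_#|~: diagram w| -> cell n,
  forall P : {mpoly K[#|~: diagram w|]}, P != 0 -> exists b b' : 'M[K]_n,
  [/\ borel b, borel b' &
    P.@[fun k => (b *m permutation_matrix K w *m b') (p k).1 (p k).2] != 0].
Proof.
have [p [pI pD Dp p_lt]] := cell_enumeration (~: diagram w).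
exists p => // P /(nonvanishing_cells pI pD Dp p_lt)[z z0 Pz].
exists (left_mx p z), (right_mx p z); split; [exact: borel_left|exact: borel_right|].
by under meval_eq do rewrite param_product.
Qed.

(** * Southwest ranks and minors *)

Section Ranks.
Variables (K : fieldType) (n : nat).
Implicit Types (M b : 'M[K]_n) (c : cell n).

Lemma mxrank_mxsub_le m1 m2 n1 n2 (f : 'I_m2 -> 'I_m1) (g : 'I_n2 -> 'I_n1) (A : 'M[K]_(m1, n1)) :
  (\rank (mxsub f g A) <= \rank A)%N.
Proof.
rewrite mxsubrc; apply: leq_trans (mxrankS (rowsub_sub _ _)) _.
by rewrite -mxrank_tr trmx_mxsub -[leqRHS]mxrank_tr; apply/mxrankS/rowsub_sub.
Qed.

Lemma minor_eq0 M c k (f g : 'I_k.+1 -> 'I_n) : (sw_rank M c <= k)%N ->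
  (forall i, (c.1 <= f i)%N) -> (forall i, (g i < c.2.+1)%N) ->
  \det (\matrix_(i, j) M (f i) (g j)) = 0.
Proof.
move=> rk fc gc; apply/eqP; apply: contraT; rewrite -unitfE -unitmxE => /mxrank_unit rkE.
suff : (k.+1 <= sw_rank M c)%N by rewrite ltnNge rk.
rewrite -rkE.
have fA i : f i \in [pred i : 'I_n | (c.1 <= i)%N] by rewrite inE.
have gA i : g i \in [pred j : 'I_n | (j <= c.2)%N] by rewrite inE -ltnS.
rewrite [\matrix_(i, j) _](_ : _ = mxsub (fun i => enum_rank_in (fA ord0) (f i))
  (fun i => enum_rank_in (gA ord0) (g i)) (mxsub (@enum_val _ [pred i : 'I_n | (c.1 <= i)%N])
               (@enum_val _ [pred j : 'I_n | (j <= c.2)%N]) M)).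
  exact: mxrank_mxsub_le.
by apply/matrixP => i j; rewrite !mxE !enum_rankK_in.
Qed.

(** Upper triangular factors combine a row only with rows south of it and a column only with columns
    west of it, so the southwest block is multiplied by blocks of b and b'. *)
Lemma sw_rank_mul_upper b M b' c : is_trig_mx b^T -> is_trig_mx b'^T ->
  (sw_rank (b *m M *m b') c <= sw_rank M c)%N.
Proof.
move=> /is_trig_mxP bT /is_trig_mxP b'T; rewrite /sw_rank.
set f := @enum_val _ [pred i : 'I_n | _]; set g := @enum_val _ [pred i : 'I_n | _].
have fb (X : 'M[K]_n) : rowsub f (b *m X) = mxsub f f b *m rowsub f X.
  apply/matrixP => i j; rewrite !mxE (bigID [pred i : 'I_n | (c.1 <= i)%N]) /= addrC.
  rewrite big1 ?add0r => [|k].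
    rewrite (eq_bigl (mem [pred i : 'I_n | (c.1 <= i)%N])) // big_enum_val.
    by apply: eq_bigr => k _; rewrite !mxE.
  rewrite -ltnNge => kc; have := bT k (f i); rewrite mxE => ->; first by rewrite mul0r.
  by apply: leq_trans kc _; have := enum_valP i; rewrite inE.
have gb m (X : 'M[K]_(m, n)) : colsub g (X *m b') = colsub g X *m mxsub g g b'.
  apply/matrixP => i j; rewrite !mxE (bigID [pred i : 'I_n | (i <= c.2)%N]) /= addrC.
  rewrite big1 ?add0r => [|k].
    rewrite (eq_bigl (mem [pred i : 'I_n | (i <= c.2)%N])) // big_enum_val.
    by apply: eq_bigr => k _; rewrite !mxE.
  rewrite -ltnNge => kc; have := b'T (g j) k; rewrite mxE => ->; first by rewrite mulr0.
  by apply: leq_ltn_trans kc; have := enum_valP j; rewrite inE.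
rewrite mxsubcr -mul_rowsub_mx gb fb -mulmx_colsub -mxsubcr.
by apply: leq_trans (mxrankM_maxl _ _) _; apply: mxrankM_maxr.
Qed.

Lemma sw_rank_permutation (w : 'S_n) c :
  (sw_rank (permutation_matrix K w) c <= dots w c.1 c.2.+1)%N.
Proof.
rewrite /sw_rank; set f := @enum_val _ [pred i : 'I_n | _].
pose A := [pred i : 'I_n | (i <= c.2)%N].
pose B := mxsub f (@enum_val _ A) (permutation_matrix K w).
(* A sum of matrices of rank at most one, over the columns whose dot lies in the block. *)
have -> : mxsub f (@enum_val _ A) (permutation_matrix K w) =
    \sum_(j | (c.1 <= w (enum_val j))%N) col j B *m (delta_mx 0 j : 'rV_#|A|).
  apply/matrixP => i j; rewrite summxE.
  under eq_bigr do rewrite mxE big_ord1 !mxE eqxx /=.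
  rewrite big_mkcond (bigD1 j) //= eqxx mulr1 big1 ?addr0 => [|k kj]; last first.
    by case: ifP => // _; rewrite [j == k]eq_sym (negbTE kj) mulr0.
  rewrite !mxE; case: ifPn => // wj; case: eqP => // fw; case/negP: wj.
  by rewrite -fw; have := enum_valP i; rewrite inE.
apply: leq_trans (_ : \sum_(j < #|A| | (c.1 <= w (enum_val j))%N) 1 <= _)%N.
  elim/big_rec2: _ => [|j k X _ IH]; first by rewrite mxrank0.
  apply: leq_trans (mxrank_add _ _) _; apply: leq_add => //.
  by apply: leq_trans (mxrankM_maxl _ _) _; apply: rank_leq_col.
rewrite big_mkcond /= -(big_enum_val (A := A) (fun j => nat_of_bool (c.1 <= w j)%N)).
exact: leq_sum.
Qed.

End Ranks.

Section Minors.
Variables (K : fieldType) (n : nat) (w : 'S_n).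
Implicit Types (M b : 'M[K]_n) (c : cell n).

(** The common consequence of [matrix_schubert] and [fulton] on which all three upper bounds
    rest. *)
Definition minors_vanish M := forall c, c \in Ess w ->
  forall f g : 'I_(dots w c.1 c.2.+1).+1 -> 'I_n,
  (forall i, c.1 <= f i)%N -> (forall i, g i < c.2.+1)%N ->
  \det (\matrix_(i, j) M (f i) (g j)) = 0.

Lemma fulton_minors M : fulton w M -> minors_vanish M.
Proof.
move=> FM c cE f g fc gc; apply: (minor_eq0 (c := c)) => //.
exact: leq_trans (FM c cE) (sw_rank_permutation K w c).
Qed.

Lemma minors_dom M c : minors_vanish M -> c \in dom w -> M c.1 c.2 = 0.
Proof.
move=> MM cd; have cD := fintype.subsetP (dom_sub_diagram w) c cd.
have [e eE [e1 e2 e3]] := diagram_Ess cD; rewrite dots_dom // in e3.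
have := MM e eE (fun=> c.1) (fun=> c.2) (fun=> e1) (fun=> e2).
by rewrite e3 det_mx11 mxE.
Qed.

Lemma fulton_BwB b b' : is_trig_mx b^T -> is_trig_mx b'^T ->
  fulton w (b *m permutation_matrix K w *m b').
Proof. by move=> bT b'T c _; apply: sw_rank_mul_upper. Qed.

Lemma fulton_mulr M b : fulton w M -> is_trig_mx b^T -> fulton w (M *m b).
Proof.
move=> FM bT c cE; apply: leq_trans (FM c cE); rewrite -{1}[M]mul1mx.
by apply: sw_rank_mul_upper => //; rewrite trmx1 scalar_mx_is_trig.
Qed.

Lemma matrix_schubert_minors M : matrix_schubert w M -> minors_vanish M.
Proof.
move=> XM c cE f g fc gc.
pose v (x : cell n -> K) (k : 'I_#|{: cell n}|) := x (enum_val k).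
pose p : {mpoly K[#|{: cell n}|]} := \det (\matrix_(i, j) 'X_(enum_rank (f i, g j))).
have pE N : peval p (entries N) = \det (\matrix_(i, j) N (f i) (g j)).
  rewrite /peval -det_map_mx; congr (\det _); apply/matrixP => i j.
  by rewrite !mxE /= mevalXU enum_rankK.
rewrite -pE; apply: XM => _ [N [b [b' [/andP[_ bT] /andP[_ b'T] ->]]] <-].
by rewrite pE; apply: fulton_minors => //; apply: fulton_BwB.
Qed.
End Minors.

(** * Factorization through lower triangular or symmetric matrices *)

Section Unipotent.
Variables (K : fieldType) (n : nat).
Implicit Types (V : 'M[K]_n).

Definition unipotent V := forall i j : 'I_n, (j <= i)%N -> V i j = (i == j)%:R.

Lemma unipotent_trig V : unipotent V -> is_trig_mx V^T.
Proof.
move=> VU; apply/is_trig_mxP => i j ij; rewrite mxE VU ?(ltnW ij) //.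
by rewrite -val_eqE /= gtn_eqF.
Qed.

Lemma unipotent_unit V : unipotent V -> V \in unitmx.
Proof.
move=> VU; rewrite -unitmx_tr unitmxE det_trig ?unipotent_trig // big1 ?unitr1 // => i _.
by rewrite mxE VU // eqxx.
Qed.

Lemma unipotentM V W : unipotent V -> unipotent W -> unipotent (V *m W).
Proof.
move=> VU WU i j ji; rewrite mxE (bigD1 j) //= WU // eqxx mulr1 VU // big1 ?addr0 // => k kj.
have [jk|kj'] := leqP j k; first by rewrite WU // (negbTE kj) mulr0.
have ki : (k < i)%N by apply: leq_trans kj' ji.
by rewrite VU ?(ltnW ki) // -val_eqE /= gtn_eqF // mul0r.
Qed.

Lemma unipotentV V : unipotent V -> unipotent (invmx V).
Proof.
move=> VU; have VV := mulmxV (unipotent_unit VU).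
suff H d : forall i j : 'I_n, (n - i <= d)%N -> (j <= i)%N -> invmx V i j = (i == j)%:R.
  by move=> i j; apply: (H n); apply: leq_subr.
elim: d => [i|d IH i j id ji]; first by rewrite leqn0 subn_eq0 leqNgt ltn_ord.
have /matrixP/(_ i j) := VV; rewrite !mxE (bigD1 i) //= VU // eqxx mul1r big1 ?addr0 // => k ki.
have [ki'|ik] := leqP k i; first by rewrite VU // eq_sym (negbTE ki) mul0r.
rewrite IH ?(leq_trans ji (ltnW ik)) //; last by have := ltn_ord i; lia.
by rewrite -val_eqE /= gtn_eqF ?mulr0 // (leq_ltn_trans ji).
Qed.

Definition lead_minor (M : 'M[K]_n) (k : 'I_n.+1) : K :=
  \det (mxsub (widen_ord (leq_ord k)) (widen_ord (leq_ord k)) M).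

(** Column j of V is a basis vector corrected in its first j entries so that column j of the product
    vanishes above the diagonal; the linear system for the correction has the leading j by j block
    as its matrix. *)
Lemma lower_of_lead_minors (M : 'M[K]_n) : (forall k, lead_minor M k != 0) ->
  exists2 V, unipotent V & is_trig_mx (M *m V).
Proof.
move=> M0.
have /choice[y yP] (j : 'I_n) : exists y : 'cV[K]_n,
    (forall i : 'I_n, (j <= i)%N -> y i 0 = (i == j)%:R) /\
    (forall i : 'I_n, (i < j)%N -> (M *m y) i 0 = 0).
  pose jj := widen_ord (leqnSn n) j; pose W := widen_ord (leq_ord jj).
  pose B := mxsub W W M; have BU : B \in unitmx by rewrite unitmxE unitfE; apply: M0.
  pose x : 'cV[K]_j := - (invmx B *m rowsub W (col j M)).
  pose E : 'M[K]_(n, j) := \matrix_(i, l) (i == W l)%:R.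
  have Ex (i : 'I_n) : (j <= i)%N -> (E *m x) i 0 = 0.
    move=> ji; rewrite mxE big1 // => l _; rewrite mxE -val_eqE /= gtn_eqF ?mul0r //.
    exact: leq_trans (ltn_ord l) ji.
  exists (E *m x + delta_mx j 0); split=> i ij.
    by rewrite mxE Ex // add0r mxE eqxx andbT.
  have ME : M *m E = colsub W M.
    apply/matrixP => a l; rewrite !mxE (bigD1 (W l)) //= mxE eqxx mulr1 big1 ?addr0 // => b bl.
    by rewrite mxE (negbTE bl) mulr0.
  have : rowsub W (M *m (E *m x + delta_mx j 0)) = 0.
    rewrite mulmxDr mulmxA ME -colE linearD /= -mul_rowsub_mx -mxsubrc.
    by rewrite -/B mulmxN mulKVmx // addNr.
  move/matrixP/(_ (Ordinal ij) 0); rewrite [LHS]mxE [RHS]mxE => <-.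
  by congr ((M *m _) _ _); apply: val_inj.
exists (\matrix_(i, j) y j i 0) => [i j ji|].
  by rewrite mxE (yP j).1 // eq_sym.
apply/is_trig_mxP => i j ij; rewrite -[RHS]((yP j).2 i ij) !mxE.
by apply: eq_bigr => a _; rewrite mxE.
Qed.
End Unipotent.

Section FallingFactorial.
Variables (K : numFieldType) (n : nat) (w : 'S_n).

(** Row i lists the values of the falling factorial of degree i. This gives an upper triangular
    matrix whose first k rows have Vandermonde-like minors, nonzero for every choice of k
    columns. *)
Definition ffact_mx : 'M[K]_n := \matrix_(i, l) \prod_(t < i) (l%:R - t%:R).

Lemma ffact_mx_trig : is_trig_mx ffact_mx^T.
Proof.
apply/is_trig_mxP => i j ij; rewrite !mxE; apply/eqP/prodf_eq0.
by exists (Ordinal ij) => //=; rewrite subrr.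
Qed.

(* A row vector in the kernel is a polynomial of degree < k, written in the Newton basis, which
   vanishes at the k values of w on the first k columns. *)
Lemma lead_minor_ffact k :
  lead_minor (ffact_mx *m permutation_matrix K w *m 1%:M) k != 0.
Proof.
set W := widen_ord (leq_ord k).
have -> : lead_minor (ffact_mx *m permutation_matrix K w *m 1%:M) k =
    \det (\matrix_(i, j) \prod_(t < i) ((w (W j))%:R - t%:R)).
  rewrite /lead_minor mulmx1; congr (\det _); apply/matrixP => i j.
  by rewrite [LHS]mxE mulmx_permutation !mxE.
rewrite -unitfE -unitmxE -row_free_unit; apply/inj_row_free => x xB.
pose q (i : nat) : {poly K} := \prod_(t < i) ('X - (t%:R)%:P).
pose f := \sum_(i < k) x 0 i *: q i.
have fw j : f.[(w (W j))%:R] = 0.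
  have /rowP/(_ j) := xB; rewrite !mxE => <-; rewrite horner_sum; apply: eq_bigr => i _.
  rewrite hornerZ horner_prod mxE; congr (_ * _); apply: eq_bigr => t _.
  by rewrite !hornerE.
have f0 : f = 0.
  apply: (@roots_geq_poly_eq0 _ f [seq (w (W j))%:R | j <- enum 'I_k]).
  - by apply/allP => _ /mapP[j _ ->]; apply/rootP.
  - rewrite map_inj_uniq ?enum_uniq // => i j /eqP; rewrite eqr_nat => /eqP/val_inj/perm_inj.
    by move/(congr1 val) => /= /val_inj.
  rewrite size_map size_enum_ord; apply/leq_sizeP => j kj; rewrite coef_sum big1 // => i _.
  rewrite coefZ nth_default ?mulr0 // size_prod_XsubC.
  by rewrite [index_enum _]unlock -enumT size_enum_ord (leq_trans _ kj).
have xi0 m (mk : (m < k)%N) : x 0 (Ordinal mk) = 0.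
  elim/ltn_ind: m mk => m IH mk; have := congr1 (horner^~ m%:R) f0.
  rewrite horner_sum horner0 (bigD1 (Ordinal mk)) //= big1 ?addr0 => [/eqP|i im].
    rewrite hornerZ mulf_eq0 => /orP[/eqP //|]; rewrite horner_prod => /eqP/eqP/prodf_eq0[t _].
    by rewrite !hornerE subr_eq0 eqr_nat gtn_eqF.
  rewrite hornerZ; case: (ltngtP i m) => [lim|mi|e].
  - have := IH _ lim (ltn_ord i); rewrite (_ : Ordinal _ = i); last exact: val_inj.
    by move=> ->; rewrite mul0r.
  - apply/eqP; rewrite mulf_eq0 horner_prod; apply/orP; right; apply/prodf_eq0.
    by exists (Ordinal mi); rewrite //= hornerXsubC subrr.
  - by move: im; rewrite -val_eqE /= e eqxx.
by apply/rowP => -[m mk]; rewrite xi0 mxE.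
Qed.
End FallingFactorial.

Section PolynomialFunctions.
Variable K : fieldType.
Implicit Types f g : K -> K.

Definition polyfun f := exists p : {poly K}, forall t, f t = p.[t].

Lemma polyfun_cst c : polyfun (fun=> c).
Proof. by exists c%:P => t; rewrite hornerC. Qed.

Lemma polyfunM f g : polyfun f -> polyfun g -> polyfun (fun t => f t * g t).
Proof. by move=> [p pE] [q qE]; exists (p * q) => t; rewrite hornerM pE qE. Qed.

Lemma polyfun_sum I (r : seq I) (F : I -> K -> K) :
  (forall i, polyfun (F i)) -> polyfun (fun t => \sum_(i <- r) F i t).
Proof.
move=> /choice[p pE]; exists (\sum_(i <- r) p i) => t.
by rewrite horner_sum; apply: eq_bigr => i _; rewrite pE.
Qed.

Lemma polyfun_prod I (r : seq I) (F : I -> K -> K) :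
  (forall i, polyfun (F i)) -> polyfun (fun t => \prod_(i <- r) F i t).
Proof.
move=> /choice[p pE]; exists (\prod_(i <- r) p i) => t.
by rewrite horner_prod; apply: eq_bigr => i _; rewrite pE.
Qed.

Lemma polyfunX f k : polyfun f -> polyfun (fun t => f t ^+ k).
Proof. by move=> [p pE]; exists (p ^+ k) => t; rewrite horner_exp pE. Qed.

Lemma polyfun_mulmx m n k (A : K -> 'M[K]_(m, n)) (B : K -> 'M[K]_(n, k)) :
  (forall i j, polyfun (fun t => A t i j)) -> (forall i j, polyfun (fun t => B t i j)) ->
  forall i j, polyfun (fun t => (A t *m B t) i j).
Proof.
move=> PA PB i j; have [p pE] := polyfun_sum (index_enum 'I_n) (fun l => polyfunM (PA i l) (PB l j)).
by exists p => t; rewrite -pE mxE.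
Qed.

Lemma polyfun_det n (A : K -> 'M[K]_n) :
  (forall i j, polyfun (fun t => A t i j)) -> polyfun (fun t => \det (A t)).
Proof.
move=> PA; apply: polyfun_sum => s; apply: polyfunM; first exact: polyfun_cst.
exact: polyfun_prod.
Qed.

Lemma polyfun_meval e (P : {mpoly K[e]}) (h : K -> 'I_e -> K) :
  (forall k, polyfun (h^~ k)) -> polyfun (fun t => P.@[h t]).
Proof.
move=> Ph; have [|p pE] := @polyfun_sum _ (msupp P) (fun m t => P@_m * \prod_k h t k ^+ m k).
  move=> m; apply: polyfunM; first exact: polyfun_cst.
  by apply: polyfun_prod => k; apply: polyfunX.
by exists p => t; rewrite -pE mevalE.
Qed.
End PolynomialFunctions.

Lemma polyfun_common_nonzero (K : numFieldType) (f g : K -> K) a b : polyfun f -> polyfun g ->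
  f a != 0 -> g b != 0 -> exists t, f t != 0 /\ g t != 0.
Proof.
move=> [p pE] [q qE]; rewrite pE qE => pa qb.
have [t] : exists t, (p * q).[t] != 0.
  apply: poly_nonroot; rewrite mulf_neq0 //.
    by apply: contraNneq pa => ->; rewrite horner0.
  by apply: contraNneq qb => ->; rewrite horner0.
by rewrite hornerM mulf_eq0 negb_or -pE -qE => /andP[]; exists t.
Qed.

Section Factorizations.
Variables (K : numFieldType) (n : nat) (w : 'S_n).

(* The matrix built from falling factorials and the given one are joined by a line inside the
   closure of BwB. *)
Lemma generic_BwB (e : nat) (p : 'I_e -> cell n) (P : {mpoly K[e]}) (b1 b1' : 'M[K]_n) :
  is_trig_mx b1^T -> is_trig_mx b1'^T ->
  P.@[fun k => (b1 *m permutation_matrix K w *m b1') (p k).1 (p k).2] != 0 ->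
  exists M, [/\ fulton w M, forall k, lead_minor M k != 0 & P.@[fun k => M (p k).1 (p k).2] != 0].
Proof.
move=> b1T b1'T Pb.
pose mix (a b : 'M[K]_n) t := (1 - t) *: a + t *: b.
have mix_trig a b t : is_trig_mx a^T -> is_trig_mx b^T -> is_trig_mx (mix a b t)^T.
  move=> /is_trig_mxP aT /is_trig_mxP bT; apply/is_trig_mxP => i j ij.
  have := aT i j ij; have := bT i j ij; rewrite !mxE => -> ->.
  by rewrite !mulr0 addr0.
have mix_poly a b i j : polyfun (fun t => mix a b t i j).
  exists ((1 - 'X) * (a i j)%:P + 'X * (b i j)%:P) => t.
  by rewrite /mix !mxE !hornerE.
pose M t := mix b1 (ffact_mx K n) t *m permutation_matrix K w *m mix b1' 1%:M t.
have M_poly i j : polyfun (fun t => M t i j).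
  apply: polyfun_mulmx; last exact: mix_poly.
  apply: polyfun_mulmx; first exact: mix_poly.
  by move=> *; apply: polyfun_cst.
have M0 : M 0 = b1 *m permutation_matrix K w *m b1'.
  by rewrite /M /mix subr0 !scale1r !scale0r !addr0.
have M1 : M 1 = ffact_mx K n *m permutation_matrix K w *m 1%:M.
  by rewrite /M /mix subrr !scale1r !scale0r !add0r.
(* One condition holds at t = 0, the other at t = 1. At the common t the factors may be singular,
   but they are still upper triangular, which is enough for [fulton]. *)
have [||||t [Pt mt]] := @polyfun_common_nonzero K (fun t => P.@[fun k => M t (p k).1 (p k).2])
    (fun t => \prod_k lead_minor (M t) k) 0 1.
- by apply: polyfun_meval => k; apply: M_poly.
- apply: polyfun_prod => k; apply: polyfun_det => i j.
  by have [q qE] := M_poly (widen_ord (leq_ord k) i) (widen_ord (leq_ord k) j); exists q => t;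
    rewrite -qE mxE.
- by rewrite M0.
- by rewrite M1; apply/prodf_neq0 => k _; apply: lead_minor_ffact.
exists (M t); split=> //.
  by apply: fulton_BwB; apply: mix_trig; rewrite // ?ffact_mx_trig // trmx1 scalar_mx_is_trig.
by move=> k; move/prodf_neq0: mt; apply.
Qed.

Lemma lower_factorization M : fulton w M -> (forall k, lead_minor M k != 0) ->
  exists Z V : 'M[K]_n, [/\ is_trig_mx Z, fulton w Z, unipotent V & M = Z *m V].
Proof.
move=> FM /lower_of_lead_minors[V VU LT].
exists (M *m V), (invmx V); split=> //; [|exact: unipotentV|].
  by apply: fulton_mulr => //; apply: unipotent_trig.
by rewrite mulmxK // unipotent_unit.
Qed.

Lemma symmetric_factorization M : fulton w M -> (forall k, lead_minor M k != 0) ->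
  exists Z V : 'M[K]_n, [/\ Z^T = Z, fulton w Z, unipotent V & M = Z *m V].
Proof.
move=> FM M0; have [L [V [LT FL VU ML]]] := lower_factorization FM M0.
have L0 i : L i i != 0.
  have : \det M != 0.
    have := M0 ord_max; rewrite /lead_minor (_ : mxsub _ _ M = M) //.
    by apply/matrixP => a b; rewrite mxE; congr (M _ _); apply: val_inj.
  rewrite ML det_mulmx mulf_eq0 negb_or det_trig // => /andP[/prodf_neq0 + _].
  exact.
pose d : 'rV[K]_n := \row_i (L i i)^-1.
have UU : unipotent (diag_mx d *m L^T).
  move=> i j ji; rewrite mul_diag_mx !mxE.
  have [<-|ij] := eqVneq i j; first by rewrite mulVf.
  rewrite (elimT is_trig_mxP LT j i) ?mulr0 //.
  by rewrite ltn_neqAle ji andbT eq_sym.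
exists (L *m (diag_mx d *m L^T)), (invmx (diag_mx d *m L^T) *m V); split.
- by rewrite !trmx_mul trmxK tr_diag_mx mulmxA.
- by apply: fulton_mulr => //; apply: unipotent_trig.
- by apply: unipotentM => //; apply: unipotentV.
- by rewrite -[_ *m (_ *m V)]mulmxA mulKVmx ?unipotent_unit.
Qed.
End Factorizations.

(** * Weight cones and dimensions *)

Section Cone.
Variables (R : realFieldType) (n : nat) (w : 'S_n).
Implicit Types (W : {vspace 'rV[R]_n * 'rV[R]_n}).

(** The rank is 0 on dom(w) but positive at diagonal cells, by [dots_lower]. Just below the
    diagonal, in the next lemma, positivity comes from [dots_staircase]. *)
Lemma Lset_diag (i j k : 'I_n) : (i, j) \in SW w -> (i <= k)%N -> (k <= j)%N -> (k, k) \in Lset w.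
Proof.
rewrite !inE => /exists_inP[e eE /andP[/= e1 e2]] ik kj; apply/andP; split; last first.
  by apply/exists_inP; exists e; rewrite //= (leq_trans e1 ik) (leq_trans kj e2).
apply/negP => /dots_dom /= d0; have := dots_lower w k (ltn_ord k).
by rewrite d0 addn0 ltnn.
Qed.

Lemma Lset_subdiag (i j k l : 'I_n) : (i, j) \in SW w -> (i <= k)%N -> (k < j)%N ->
  l = k.+1 :> nat -> (l, k) \in Lset w.
Proof.
rewrite !inE => /exists_inP[e eE /andP[/= e1 e2]] ik kj lk; apply/andP; split; last first.
  apply/exists_inP; exists e; rewrite //= lk (leq_trans (leq_trans e1 ik)) //=.
  exact: leq_trans (ltnW kj) e2.
apply/negP => /dots_dom /=; rewrite lk => d0.
have eD : e \in diagram w by move: eE; rewrite inE => /andP[].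
by have := dots_staircase eD (leq_trans e1 ik) (leq_trans kj e2); rewrite d0.
Qed.

Lemma ray_in_weight_cone (A : {set cell n}) c : c \in A -> @weight_cone R n A (@ray R n c).
Proof.
move=> cA; exists (fun d => (d == c)%:R) => [d|]; first exact: ler0n.
rewrite (bigD1 c) //= eqxx scale1r big1 ?addr0 // => d /andP[_ /negbTE ->].
by rewrite scale0r.
Qed.

(* Above the diagonal, ray (i, k+1) = ray (i, k) - ray (k+1, k) + ray (k+1, k+1). *)
Lemma ray_mem_low W c : (forall v, @weight_cone R n (Lset w :&: Dlow n) v -> v \in W) ->
  c \in Lset w -> @ray R n c \in W.
Proof.
move=> WC cL; have LW d : d \in Lset w -> (d.2 <= d.1)%N -> @ray R n d \in W.
  by move=> dL dl; apply/WC/ray_in_weight_cone; move: dL; rewrite !inE dl andbT.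
case: (leqP c.2 c.1) => [|ij]; first exact: LW.
have cSW : (c.1, c.2) \in SW w by move: cL; rewrite -surjective_pairing inE => /andP[].
suff H m (mn : (m < n)%N) : (c.1 <= m)%N -> (m <= c.2)%N -> @ray R n (c.1, Ordinal mn) \in W.
  have := H c.2 (ltn_ord _) (ltnW ij) (leqnn _).
  by rewrite (_ : (c.1, _) = c) // [RHS]surjective_pairing; congr pair; apply: val_inj.
elim: m mn => [|m IH] mn im mj.
  apply: LW => //; rewrite (_ : c.1 = Ordinal mn).
    by apply: (Lset_diag cSW).
  by apply: val_inj; move: im; rewrite leqn0 => /eqP.
have [e|im'] := eqVneq (val c.1) m.+1.
  have -> : c.1 = Ordinal mn by apply: val_inj.
  by apply: LW => //; apply: (Lset_diag cSW).
have mn' : (m < n)%N by apply: ltnW.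
have cm : (c.1 <= m)%N by rewrite -ltnS ltn_neqAle im'.
have -> : @ray R n (c.1, Ordinal mn) = @ray R n (c.1, Ordinal mn') -
    @ray R n (Ordinal mn, Ordinal mn') + @ray R n (Ordinal mn, Ordinal mn).
  by rewrite /ray /=; congr pair; rewrite /= ?subrK // opprK addNr add0r.
apply: memvD; first apply: memvB.
- by apply: IH => //; apply: ltnW.
- by apply: LW => //=; apply: (Lset_subdiag cSW).
- by apply: LW => //=; apply: (Lset_diag cSW).
Qed.

Lemma cone_dim_low b : cone_dim (sigma R w) b -> cone_dim (sigma_low R w) b.
Proof.
case=> U [UC Umin Ub]; exists U; split=> // [v [a a0 <-]|W WC].
  apply: memv_suml => c; rewrite inE => /andP[cL _]; apply/memvZ/UC.
  exact: ray_in_weight_cone.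
apply: Umin => v [a a0 <-]; apply: memv_suml => c cL; apply: memvZ.
exact: ray_mem_low.
Qed.
End Cone.

(** * Dimensions of the three varieties *)

Section Dimension.
Variables (K : numFieldType) (n : nat) (w : 'S_n).

Lemma variety_dim_unique (I : finType) (X : set (I -> K)) a b :
  variety_dim X a -> variety_dim X b -> a = b.
Proof.
move=> [[f fX] ua] [[g gX] ub]; apply/eqP.
by rewrite eqn_leq (ub _ _ fX) (ua _ _ gX).
Qed.

(** The upper bound in a form shared by the three varieties: [tau] finds the coordinate carrying a
    matrix entry, [h] the cell behind a coordinate of X, and entries outside A are masked by 0. *)
Lemma dim_upper (U A : {set cell n}) (tau : cell n -> cell n) (Q : 'M[K]_n -> Prop)
    (I : finType) (h : I -> cell n) (X : set (I -> K)) :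
  A \subset U -> U \subset SW w -> SW w :\: U \subset Dup n ->
  (forall c, c \in A -> tau c = c) ->
  (forall c, ((tau c).1 * (tau c).2 = c.1 * c.2)%N) ->
  (forall M, Q M -> minors_vanish w M) ->
  (forall M, Q M -> forall c, c \in SW w ->
    M c.1 c.2 = if tau c \in A then M (tau c).1 (tau c).2 else 0) ->
  (forall x, X x -> exists2 M, Q M & forall i, x i = if h i \in A then M (h i).1 (h i).2 else 0) ->
  forall (e : nat) (f : 'I_e -> {mpoly K[#|I|]}), alg_independent_on X f ->
  (e <= #|U| - #|diagram w|)%N.
Proof.
move=> AU UW WU tauA tauM QM QA XQ e f fX; rewrite leqNgt; apply/negP => Ne.
pose Z (v : 'I_#|{: cell n}| -> K) := exists2 M, Q M &
  forall c, v (enum_rank c) = if c \in A then M c.1 c.2 else 0.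
pose F k := f k \mPo [tuple 'X_(enum_rank (h (enum_val j))) | j < #|I|].
have [|v [M _ vM] c /negbTE cA|v [M QM' vM] c cE g g' gc g'c|P [P0 PZ]] :=
    @dependent_of_diagonal K n w A tau (#|U| - #|diagram w|) Z _ _ tauA tauM _ e F Ne.
- move=> S SA cS; rewrite leq_subRL ?card_diagram_le // addnC.
  by apply: card_chain_le_masked cS => //; apply: fintype.subset_trans SA AU.
- by rewrite vM cA.
- rewrite -(QM M QM' c cE g g' gc g'c); congr (\det _); apply/matrixP => i j.
  by rewrite !mxE vM -QA //; apply: (mem_SW_region cE); [exact: gc|exact: g'c].
case/eqP: P0; apply: fX => x /XQ[M QM' xM].
pose v (k : 'I_#|{: cell n}|) := let c : cell n := enum_val k in if c \in A then M c.1 c.2 else 0.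
rewrite -[RHS](PZ v); last by exists M => // c; rewrite /v enum_rankK.
apply: meval_eq => k; rewrite /F comp_mpoly_meval; apply: meval_eq => j.
by rewrite tnth_mktuple mevalXU /v enum_rankK xM.
Qed.

(** Of the n^2 - |D(w)| independent functions at most n^2 - |U| can be accounted for by coordinates
    outside A and B, and those in B vanish; the rest must come from A. *)
Lemma dim_lower (e : nat) (U A B A' : {set cell n}) (T : ('I_#|{: cell n}| -> K) -> Prop)
    (X : set ({c : cell n | c \in A'} -> K)) (G : 'I_e -> {mpoly K[#|{: cell n}|]}) :
  e = #|~: diagram w| -> A \subset A' -> U \subset A :|: B -> (#|diagram w| <= #|U|)%N ->
  (forall v, T v -> forall c, c \in B -> v (enum_rank c) = 0) ->
  (forall P : {mpoly K[e]}, P != 0 -> exists2 v, T v & P.@[fun k => (G k).@[v]] != 0) ->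
  (forall v, T v -> exists2 x, X x & forall i, val i \in A -> x i = v (enum_rank (val i))) ->
  exists f : 'I_(#|U| - #|diagram w|) -> {mpoly K[#|{: {c : cell n | c \in A'}}|]},
    alg_independent_on X f.
Proof.
move=> eE AA' UAB DU TB GP TX.
pose Am := [set i : 'I_#|{: cell n}| | (enum_val i : cell n) \in A].
pose Bm := [set i : 'I_#|{: cell n}| | (enum_val i : cell n) \in B].
have cardE : #|~: (Am :|: Bm)| = #|~: (A :|: B)|.
  rewrite -[RHS](card_imset _ (@enum_rank_inj _)); apply: eq_card => i.
  apply/idP/imsetP => [iN|[c cN ->]].
    by exists (enum_val i); rewrite ?enum_valK // !inE in iN *.
  by rewrite !inE !enum_rankK in cN *.
have UN : (#|U| - #|diagram w| + #|~: (Am :|: Bm)| <= e)%N.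
  rewrite cardE eE; have := cardsC (diagram w); have := cardsC (A :|: B).
  by have := subset_leq_card UAB; move: DU; lia.
have [v vT i|s [sI sA sP]] := @indep_coordinates K _ e _ T Am Bm G _ GP UN.
  by rewrite inE => iB; rewrite -(TB v vT _ iB) enum_valK.
have sA' k : (enum_val (s k) : cell n) \in A'.
  by apply: (fintype.subsetP AA'); have := sA k; rewrite inE.
exists (fun k => 'X_(enum_rank (exist (fun c => c \in A') _ (sA' k)))) => P PX.
apply: sP => v /TX[x xX xv]; rewrite -[RHS](PX x xX); apply: meval_eq => k.
rewrite /peval mevalXU enum_rankK xv /= ?enum_valK //.
by have := sA k; rewrite inE.
Qed.

Lemma matrix_schubert_BwB (b b' : 'M[K]_n) : borel b -> borel b' ->
  matrix_schubert w (b *m permutation_matrix K w *m b').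
Proof.
move=> bB b'B p pB; apply: pB; exists (b *m permutation_matrix K w *m b') => //.
by exists b, b'.
Qed.

Lemma Lset_sub_SW : Lset w \subset SW w.
Proof. exact: subsetDl. Qed.

Lemma SW_cases c : c \in SW w -> c \in Lset w \/ c \in dom w.
Proof. by rewrite [c \in Lset w]finset.in_setD => ->; case: (c \in dom w); [right|left]. Qed.

Lemma SW_antidiag (c d : cell n) : c \in SW w -> (c.1 <= d.1)%N -> (d.2 <= c.2)%N -> d \in SW w.
Proof.
rewrite !inE => /exists_inP[e eE /andP[e1 e2]] cd dc; apply/exists_inP; exists e => //.
by rewrite (leq_trans e1 cd) (leq_trans dc e2).
Qed.

Theorem variety_dim_Y : variety_dim (Y K w) (#|SW w| - #|diagram w|).
Proof.
have WW : SW w :\: SW w \subset Dup n by rewrite finset.setDv finset.sub0set.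
split; last first.
  apply: (@dim_upper (SW w) (Lset w) id (matrix_schubert w) _ val) => //.
  - exact: Lset_sub_SW.
  - exact: matrix_schubert_minors.
  - move=> M /matrix_schubert_minors MM c; case: ifPn => // cL /SW_cases[cL'|].
      by rewrite cL' in cL.
    exact: minors_dom.
  - by move=> _ [M MX <-]; exists M => // i; rewrite (valP i).
have [p pP] := BwB_nonvanishing K w.
apply: (@dim_lower _ (SW w) (Lset w) (dom w) (Lset w)
  (fun v => exists2 M, matrix_schubert w M & forall c, v (enum_rank c) = M c.1 c.2)
  (Y K w) (fun k => 'X_(enum_rank (p k)))) => //.
- by apply/fintype.subsetP => c /SW_cases; rewrite finset.in_setU => -[] ->; rewrite ?orbT.
- by rewrite card_diagram_le.
- by move=> v [M /matrix_schubert_minors MM vM] c cd; rewrite vM (minors_dom MM).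
- move=> P /pP[b [b' [bB b'B Pb]]].
  pose M := b *m permutation_matrix K w *m b'.
  pose v (k : 'I_#|{: cell n}|) := let c : cell n := enum_val k in M c.1 c.2.
  exists v; first by exists M; [exact: matrix_schubert_BwB|move=> c; rewrite /v enum_rankK].
  by under meval_eq do rewrite mevalXU /v enum_rankK.
- move=> v [M MX vM]; exists (fun c => entries M (val c)); first by exists M.
  by move=> i _; rewrite vM.
Qed.

Let U := SW w :&: Dlow n.

Lemma SW_low_sub : U \subset SW w.
Proof. exact: subsetIl. Qed.

Lemma SW_low_compl : SW w :\: U \subset Dup n.
Proof.
apply/fintype.subsetP => c; rewrite finset.in_setD finset.in_setI => /andP[+ cS].
by rewrite cS /= !inE ltnNge.
Qed.

(* In a generic product M = Z V of BwB, the lower triangle of the coordinate matrix records Z and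
   the strict upper triangle records V, so that Z keeps all parameters of M but |Dup| many. *)
Lemma dim_lower_factorization (Q : 'M[K]_n -> Prop) (pz : 'I_n -> 'I_n -> {mpoly K[#|{: cell n}|]})
    (A' : {set cell n}) (X : set ({c : cell n | c \in A'} -> K)) :
  (forall M, fulton w M -> (forall k, lead_minor M k != 0) ->
    exists Z V : 'M[K]_n, [/\ Q Z, unipotent V & M = Z *m V]) ->
  (forall Z, Q Z -> minors_vanish w Z) ->
  (forall Z v, Q Z -> (forall c, c \in Dlow n -> v (enum_rank c) = Z c.1 c.2) ->
    forall i l, (pz i l).@[v] = Z i l) ->
  Lset w :&: Dlow n \subset A' ->
  (forall Z, Q Z -> exists2 x, X x & forall i, val i \in Lset w :&: Dlow n ->
    x i = Z (val i).1 (val i).2) ->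
  exists f : 'I_(#|U| - #|diagram w|) -> {mpoly K[#|{: {c : cell n | c \in A'}}|]},
    alg_independent_on X f.
Proof.
move=> QF QM pzE AA' XQ.
have [p pP] := BwB_nonvanishing K w.
(* The entries of V as polynomials in the coordinates. Those of Z are left to [pz], which above the
   diagonal is zero or a reflection. *)
pose pv (l j : 'I_n) : {mpoly K[#|{: cell n}|]} :=
  if (l < j)%N then 'X_(enum_rank (l, j)) else ((l == j)%:R)%:MP.
pose T (v : 'I_#|{: cell n}| -> K) := exists Z V : 'M[K]_n, [/\ Q Z, unipotent V &
  forall c, v (enum_rank c) = if c \in Dlow n then Z c.1 c.2 else V c.1 c.2].
apply: (@dim_lower _ U (Lset w :&: Dlow n) (dom w :&: Dlow n) A' T X
  (fun k => \sum_l pz (p k).1 l * pv l (p k).2)) => //.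
- apply/fintype.subsetP => c; rewrite finset.in_setI => /andP[/SW_cases + cl].
  by rewrite finset.in_setU !finset.in_setI cl !andbT => -[] ->; rewrite ?orbT.
- exact: card_diagram_le SW_low_sub SW_low_compl.
- move=> v [Z [V [QZ _ vE]]] c; rewrite finset.in_setI => /andP[cd cl].
  by rewrite vE cl; apply: minors_dom cd; apply: QM.
- move=> P /pP[b [b' [/andP[_ bT] /andP[_ b'T] Pb]]].
  have [M [FM M0 PM]] := generic_BwB bT b'T Pb.
  have [Z [V [QZ VU MZV]]] := QF M FM M0.
  pose v (k : 'I_#|{: cell n}|) := let c : cell n := enum_val k in
    if c \in Dlow n then Z c.1 c.2 else V c.1 c.2.
  have vE c : v (enum_rank c) = if c \in Dlow n then Z c.1 c.2 else V c.1 c.2.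
    by rewrite /v enum_rankK.
  exists v; first by exists Z, V.
  suff E k : (\sum_l pz (p k).1 l * pv l (p k).2).@[v] = M (p k).1 (p k).2.
    by under meval_eq do rewrite E.
  rewrite raddf_sum /= MZV mxE; apply: eq_bigr => l _; rewrite mevalM; congr (_ * _).
    by apply: pzE => // c cl; rewrite vE cl.
  rewrite /pv; case: ltnP => lj; last by rewrite mevalC VU.
  by rewrite mevalXU vE inE /= leqNgt lj.
- move=> v [Z [V [QZ _ vE]]]; have [x xX xE] := XQ Z QZ; exists x => // i iA.
  by rewrite xE // vE; move: iA; rewrite finset.in_setI => /andP[_ ->].
Qed.

Theorem variety_dim_Ylow : variety_dim (Ylow K w) (#|U| - #|diagram w|).
Proof.
split.
  apply: (@dim_lower_factorization (matrix_schubert_low w)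
    (fun i l => if (l <= i)%N then 'X_(enum_rank (i, l)) else 0)) => //.
  - move=> M FM M0; have [Z [V [ZT FZ VU MZV]]] := lower_factorization FM M0.
    by exists Z, V.
  - by move=> Z [_ /fulton_minors].
  - move=> Z v [/is_trig_mxP ZT _] vZ i l; case: leqP => il; last by rewrite meval0 ZT.
    by rewrite mevalXU vZ ?inE.
  - by move=> Z ZX; exists (fun c => entries Z (val c)); first by exists Z.
apply: (@dim_upper U (Lset w :&: Dlow n) id (matrix_schubert_low w) _ val) => //.
- exact: finset.setSI Lset_sub_SW.
- exact: SW_low_sub.
- exact: SW_low_compl.
- by move=> M [_ /fulton_minors].
- move=> M [/is_trig_mxP MT FM] c cS; case: ifPn => //; rewrite finset.in_setI negb_and.
  have [cL /=|cd _] := SW_cases cS; last exact: minors_dom (fulton_minors FM) cd.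
  by rewrite cL inE -ltnNge => /MT.
- by move=> _ [M MX <-]; exists M => // i; rewrite (valP i).
Qed.

Definition low_cell (c : cell n) : cell n := if (c.1 < c.2)%N then (c.2, c.1) else c.

Lemma low_cell_SW c : c \in SW w -> low_cell c \in SW w.
Proof.
rewrite /low_cell; case: ifP => // ci cS.
by apply: SW_antidiag cS _ _ => /=; apply: ltnW.
Qed.

Lemma low_cell_low c : low_cell c \in Dlow n.
Proof. by rewrite /low_cell inE; case: ltnP => //= /ltnW. Qed.

Lemma low_cell_sym (M : 'M[K]_n) c : M^T = M -> M (low_cell c).1 (low_cell c).2 = M c.1 c.2.
Proof. by move=> MT; rewrite /low_cell; case: ifP => //= _; rewrite -{1}MT mxE. Qed.

Lemma low_cell_swap (c : cell n) : low_cell (c.2, c.1) = low_cell c.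
Proof.
case: c => i j; rewrite /low_cell /=; case: ltngtP => // /val_inj -> //.
Qed.

Theorem variety_dim_Ysym : variety_dim (Ysym K w) (#|U| - #|diagram w|).
Proof.
split.
  apply: (@dim_lower_factorization (matrix_schubert_sym w)
    (fun i l => 'X_(enum_rank (low_cell (i, l))))) => //.
  - move=> M FM M0; have [Z [V [ZT FZ VU MZV]]] := symmetric_factorization FM M0.
    by exists Z, V.
  - by move=> Z [_ /fulton_minors].
  - by move=> Z v [ZT _] vZ i l; rewrite mevalXU vZ ?low_cell_low // low_cell_sym.
  - by apply: fintype.subset_trans (subsetIl _ _) (finset.subsetUl _ _).
  - by move=> Z ZX; exists (fun c => entries Z (val c)); first by exists Z.
have cases (M : 'M[K]_n) c : matrix_schubert_sym w M -> low_cell c \in SW w ->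
    M c.1 c.2 = if low_cell c \in Lset w :&: Dlow n then M (low_cell c).1 (low_cell c).2 else 0.
  move=> [MT FM] cS; rewrite finset.in_setI low_cell_low andbT.
  case: ifPn => [|cL]; rewrite -(low_cell_sym c MT) //.
  have [cL'|cd] := SW_cases cS; first by rewrite cL' in cL.
  exact: minors_dom (fulton_minors FM) cd.
apply: (@dim_upper U (Lset w :&: Dlow n) low_cell (matrix_schubert_sym w) _ (fun i => low_cell (val i))).
- exact: finset.setSI Lset_sub_SW.
- exact: SW_low_sub.
- exact: SW_low_compl.
- move=> c; rewrite finset.in_setI => /andP[_]; rewrite inE => cl.
  by rewrite /low_cell ltnNge cl.
- by move=> c; rewrite /low_cell; case: ifP => //= _; rewrite mulnC.
- by move=> M [_ /fulton_minors].
- by move=> M MX c /low_cell_SW; apply: cases.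
- move=> _ [M MX <-]; exists M => // i; apply: cases => //.
  have := valP i; rewrite finset.in_setU => /orP[/(fintype.subsetP Lset_sub_SW)|].
    exact: low_cell_SW.
  case/imsetP => c /(fintype.subsetP Lset_sub_SW) cS ->.
  by rewrite low_cell_swap; apply: low_cell_SW.
Qed.

End Dimension.

Theorem corollary5p6 (R : realType) (n : nat) (w : 'S_n) (d : int) :
  complexity (Y R[i] w) (sigma R w) d ->
  complexity (Ylow R[i] w) (sigma_low R w)
    (d - #|SW w :&: Dup n|%:Z) /\
  complexity (Ysym R[i] w) (sigma_sym R w)
    (d - #|SW w :&: Dup n|%:Z).
Proof.
case=> a [b [Ya /cone_dim_low Cb ->]].
rewrite (variety_dim_unique Ya (variety_dim_Y R[i] w)).
have DU := card_diagram_le (SW_low_sub w) (SW_low_compl w).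
(* [DU] makes both truncated differences exact. *)
have -> : (#|SW w| - #|diagram w|)%N%:Z - b%:Z - #|SW w :&: Dup n|%:Z =
    (#|SW w :&: Dlow n| - #|diagram w|)%N%:Z - b%:Z.
  have : #|SW w| = (#|SW w :&: Dlow n| + #|SW w :&: Dup n|)%N.
    rewrite -(cardsID (Dlow n) (SW w)); congr (_ + _)%N.
    apply: eq_card => c; rewrite finset.in_setD finset.in_setI andbC.
    by rewrite [c \in Dlow n]inE [c \in Dup n]inE ltnNge.
  by move: DU; lia.
by split; exists (#|SW w :&: Dlow n| - #|diagram w|)%N, b; split=> //;
  [apply: variety_dim_Ylow|apply: variety_dim_Ysym].
Qed.
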